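(* In the setting described in the context, let $e=\{v,w\}$ be a diagonal edge of $G$ with $v\in V(H^\perp)$. Then the number of dimer coverings of $G$ containing the impurity $e$ equals $|\det A|\,p_v$. Consequently the total number of dimer coverings of $G$ is $$|\mathcal M(G)|=|\det A|\Big(4\sum_{v\in V(H^\perp)}p_v+d^*-3\Big)=|\det A|\big(4\langle\mathbf 1,A^{-1}\mathbf b\rangle+d^*+1\big),$$ where $\mathbf 1=(1,\dots,1)^t$.
   Context: Let $\Gamma$ be the graph with vertex set $\mathbb Z^2$, divided into white vertices $W=\{(x,y): x+y \text{ even}\}$ and black vertices $B=\mathbb Z^2\setminus W$; $v,v'$ are adjacent iff $v-v'\in\{\pm(1,0),\pm(0,1)\}$, or $v,v'\in W$ and $v-v'\in\{\pm(1,1),\pm(1,-1)\}$ (the latter are diagonal edges). A subgraph of $\Gamma$ is normal if it is induced by a finite vertex set and both it and the subgraph induced by the complementary vertex set are connected. A dimer covering of a graph is a set of its edges covering every vertex exactly once; a dimer covering of $G$ contains the impurity $e$ if the diagonal edge $e$ belongs to it. $\mathcal M(G)$ is the set of dimer coverings of $G$. Let $W_0=2\mathbb Z\times 2\mathbb Z$, $W_1=W_0+(1,1)$; $\Lambda$ is the graph on $W_0$ with edges $\{v,v'\}$, $v-v'\in\{\pm(2,0),\pm(0,2)\}$, and $\Lambda^\perp$ the analogous graph on $W_1$. Setting: $H$ is a finite subgraph of $\Lambda$ formed by the boundaries of a finite set $\mathcal F$ of faces of $\Lambda$ (squares of side $2$ with corners in $W_0$), with simply connected union; the centres of these faces lie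 in $W_1$. $f^*\in W_1$ is a point which is not a centre of a face in $\mathcal F$, chosen so that the subgraph of $\Lambda^\perp$ induced by the face-centres together with $f^*$ is simply connected. $H^\perp$ is the planar dual of $H$ whose outer-face vertex is $f^*$: $V(H^\perp)$ consists of the face centres and $f^*$, and for every edge $e$ of $H$ there is one edge $e^\perp$ of $H^\perp$ joining the vertices representing the two faces on either side of $e$. $d^*$ is the number of edges of $\Lambda^\perp$ joining $f^*$ to face centres. $v^*$ is a vertex of $H$ on the boundary of the outer face with $v^*-f^*\in\{\pm(1,1),\pm(1,-1)\}$. $G$ is the subgraph of $\Gamma$ induced by $V(H)\cup V(H^\perp)\cup\{\text{midpoints of edges of }H\}$, assumed normal. $A$ is the square matrix indexed by $V(H^\perp)\setminus\{f^*\}$ (the face centres) with entries $a_{u,u}=4$, $a_{u,u'}=-1$ if the faces with centres $u\neq u'$ share an edge of $H$, and $a_{u,u'}=0$ otherwise (the negative Laplacian of $H^\perp$ with the row and column of $f^*$ removed). $\mathbf b=(b_u)$ is indexed by the face centres with $b_u=1$ if $u$ is adjacent to $f^*$ in $\Lambda^\perp$ and $b_u=0$ otherwise. $A$ is invertible, and $\mathbf p=(p_u)_{u\ne f^*}=A^{-1}\mathbf b$; also $p_{f^*}=1$. (Equivalently, $p_u$ is the probability that simple random walk on $H^\perp$ started at $u$ first reaches $f^*$ through one of the edges of $\Lambda^\perp$ joining $f^*$ to a face centre.) *)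

(* Defs.v *)
From HB Require Import structures.
From mathcomp Require Import all_boot all_order all_algebra.
Set Implicit Arguments. Unset Strict Implicit. Unset Printing Implicit Defensive.
Import Order.TTheory GRing.Theory Num.Theory.
Local Open Scope ring_scope.

Definition pt := (int * int)%type.
Definition oddz (x : int) : bool := odd `|x|%N.
Definition white (v : pt) : bool := ~~ oddz (v.1 + v.2).
Definition inW0 (v : pt) : bool := ~~ oddz v.1 && ~~ oddz v.2.
Definition inW1 (v : pt) : bool := oddz v.1 && oddz v.2.

Definition dvec (v w : pt) : pt := (v.1 - w.1, v.2 - w.2).
Definition shift (c d : pt) : pt := (c.1 + d.1, c.2 + d.2).

Definition unit_steps : seq pt := [:: (1, 0); (-1, 0); (0, 1); (0, -1)].
Definition diag_steps : seq pt := [:: (1, 1); (-1, -1); (1, -1); (-1, 1)].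
Definition lam_steps : seq pt := [:: (2, 0); (-2, 0); (0, 2); (0, -2)].
Definition king_steps : seq pt :=
  lam_steps ++ [:: (2, 2); (-2, -2); (2, -2); (-2, 2)].

Definition gamma_adj : rel pt := fun v w =>
  (dvec v w \in unit_steps) || [&& white v, white w & dvec v w \in diag_steps].
Definition lam_adj : rel pt := fun v w => dvec v w \in lam_steps.
Definition king_adj : rel pt := fun v w => dvec v w \in king_steps.

(* A face of Lambda is identified by its centre c in W1. *)
Definition corners (c : pt) : seq pt := map (shift c) diag_steps.
Definition mids (c : pt) : seq pt := map (shift c) unit_steps.
Definition VH (F : seq pt) : seq pt := flatten (map corners F).
Definition Mids (F : seq pt) : seq pt := flatten (map mids F).
Definition VG (F : seq pt) (fs : pt) : seq pt := undup (VH F ++ (fs :: F) ++ Mids F).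

Definition connected_in (adj : rel pt) (S : pred pt) : Prop :=
  forall x y, S x -> S y ->
    exists p : seq pt, [/\ path adj x p, last x p = y & all S p].

(* The union of the closed squares with centres in F is simply connected:
   nonempty, connected (squares meeting in an edge or a corner) and with
   connected complement (the complementary open squares are connected
   through shared edges). *)
Definition sc_face_union (F : seq pt) : Prop :=
  [/\ F != [::], connected_in king_adj (fun c => c \in F)
    & connected_in lam_adj (fun c => inW1 c && (c \notin F))].

(* The subgraph of Lambda^perp induced by S is simply connected:
   connected and without holes (complement king-connected). *)
Definition sc_lattice_subgraph (S : seq pt) : Prop :=
  connected_in lam_adj (fun c => c \in S) /\
  connected_in king_adj (fun c => inW1 c && (c \notin S)).

Definition outer_boundary (F : seq pt) (v : pt) : bool :=
  (v \in VH F) && has (fun c => c \notin F) (map (shift v) diag_steps).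

Definition normal_graph (V : seq pt) : Prop :=
  connected_in gamma_adj (fun v => v \in V) /\
  connected_in gamma_adj (fun v => v \notin V).

Section Dimer.
Variable V : seq pt.
Definition vtx := seq_sub V.
Definition is_dimer (M : {set {set vtx}}) : bool :=
  [forall B in M, [exists x : vtx, exists y : vtx,
      gamma_adj (val x) (val y) && (B == [set x; y])]] &&
  [forall x : vtx, #|[set B in M | x \in B]| == 1%N].
Definition has_edge (M : {set {set vtx}}) (v w : pt) : bool :=
  [exists B in M, [exists x in B, val x == v] && [exists y in B, val y == w]].
Definition n_dimers : nat := #|[set M : {set {set vtx}} | is_dimer M]|.
Definition n_dimers_with (v w : pt) : nat :=
  #|[set M : {set {set vtx}} | is_dimer M && has_edge M v w]|.
End Dimer.

Definition fc (F : seq pt) (i : nat) : pt := nth (0, 0) F i.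

Definition Amx (F : seq pt) : 'M[rat]_(size F) :=
  \matrix_(i, j) (if i == j then 4 else if lam_adj (fc F i) (fc F j) then -1 else 0).
Definition bvec (F : seq pt) (fs : pt) : 'cV[rat]_(size F) :=
  \col_i (if lam_adj (fc F i) fs then 1 else 0).
Definition pvec (F : seq pt) (fs : pt) : 'cV[rat]_(size F) :=
  invmx (Amx F) *m bvec F fs.
Definition pval (F : seq pt) (fs : pt) (v : pt) : rat :=
  if v == fs then 1 else
  match [pick i : 'I_(size F) | fc F i == v] with
  | Some i => pvec F fs i ord0
  | None => 0
  end.
Definition dstar (F : seq pt) (fs : pt) : nat := count (lam_adj fs) F.

(* Main.v *)
From HB Require Import structures.
From mathcomp Require Import all_boot all_order all_fingroup all_algebra.
From mathcomp Require Import zify ring lra.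
(* After [all_fingroup], whose [perm.pval] would otherwise shadow [Defs.pval]. *)
Require Import Defs.
Import Order.TTheory GRing.Theory Num.Theory.
Local Open Scope ring_scope.
Set Implicit Arguments. Unset Strict Implicit. Unset Printing Implicit Defensive.

(**
Every dimer covering contains exactly one impurity, since [G] has two more white
than black vertices.  Fix an impurity joining a face centre [v] to a vertex [w],
and remove both.  Let [D] be the signed incidence matrix of [H] without the row
of [w], and [C] the one of the dual faces; then [D C^T = 0] and [C C^T = A].
Let [C'] be [C] with the row of [v] replaced by that of [f*].  The matrix
[M = (D; C')] is a Kasteleyn matrix for the remaining bipartite graph.

Both [D] and [C] have integral right inverses, so [B = (X | C^T)] with [D X = 1]
is unimodular and [|det M| = |det (M B)| = |det (C' C^T)|], which is
[|det A| p_v] by Cramer's rule; [p_v > 0] by the minimum principle.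

The terms of [det M] all have the same sign: if [P] is the signed permutation
matrix of a matching with upper block [P_V], then for [B' = (P_V^T | C^T)] both
[P B'] and [M B'] are block triangular, and their diagonal blocks are matrices
[1 - phi] of functional graphs, whose determinant is [1] if the graph is acyclic
and [0] otherwise.  What is needed is that the graph [V(H) \ w -> V(H)] of a
matching is acyclic.  A cycle would be the coboundary of a function [g] on faces;
by the discrete Poincare lemma every function jumping only across the cycle is a
multiple of [g], hence the support of [g] is a disc and has Euler characteristic
one.  But the matching pairs off its cells except for [v] and [w], which lie both
inside or both outside: a contradiction modulo two.

The number of corners of [f*] in [H] follows from the Euler formula applied to
[F] and to [F] together with [f*].
*)

(** * The square lattice: incidence and the discrete Poincare lemma *)

Definition black (e : pt) : bool := oddz (e.1 + e.2).
(* A black point [e] is the midpoint of the edge from [em e] to [ep e], with the faces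
   [fp e] and [fm e] on its two sides; the signs make the rows of [K] at vertices
   orthogonal to those at faces ([curlK_W0]). *)
Definition ep (e : pt) : pt :=
  if oddz e.1 then (e.1 + 1, e.2) else (e.1, e.2 + 1).
Definition em (e : pt) : pt :=
  if oddz e.1 then (e.1 - 1, e.2) else (e.1, e.2 - 1).
Definition fp (e : pt) : pt :=
  if oddz e.1 then (e.1, e.2 - 1) else (e.1 + 1, e.2).
Definition fm (e : pt) : pt :=
  if oddz e.1 then (e.1, e.2 + 1) else (e.1 - 1, e.2).

Definition K (a e : pt) : int :=
  (a == ep e)%:R + (a == fp e)%:R - (a == em e)%:R - (a == fm e)%:R.

Ltac pts := rewrite /black /ep /em /fp /fm /inW0 /inW1 /white /dvec /shift /oddz
  /gamma_adj /lam_adj /king_adj /mids /corners /unit_steps /diag_steps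
  /lam_steps /king_steps /= ?inE ?xpair_eqE /=.
Ltac ptl := pts; try lia.

Lemma pt_eqP (a b c d : int) : a = c -> b = d -> (a, b) = (c, d).
Proof. by move=> -> ->. Qed.

Lemma K_W0E x e : inW0 x -> black e -> K x e = (x == ep e)%:R - (x == em e)%:R.
Proof.
rewrite /K => x0 be; have [-> ->] : (x == fp e) = false /\ (x == fm e) = false.
  by case: x e x0 be => [a b] [c d]; pts; case: ifP => /=; rewrite ?xpair_eqE /=; lia.
by rewrite addr0 subr0.
Qed.

Lemma K_W1E f e : inW1 f -> black e -> K f e = (f == fp e)%:R - (f == fm e)%:R.
Proof.
rewrite /K => x0 be; have [-> ->] : (f == ep e) = false /\ (f == em e) = false.
  by case: f e x0 be => [a b] [c d]; pts; case: ifP => /=; rewrite ?xpair_eqE /=; lia.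
by rewrite add0r subr0.
Qed.

Lemma natb_add (a b c : bool) : ~~ (a && b) -> c = a || b -> c%:R = a%:R + b%:R :> int.
Proof. by case: a b => [] [] // _ ->. Qed.

Lemma K_W0 x e : inW0 x -> black e ->
  K x e = (e == (x.1 - 1, x.2))%:R + (e == (x.1, x.2 - 1))%:R
          - (e == (x.1 + 1, x.2))%:R - (e == (x.1, x.2 + 1))%:R.
Proof.
move=> x0 be; rewrite K_W0E // -addrA -opprD.
by congr (_ - _); apply: natb_add;
  case: x e x0 be => [a b] [c d]; pts; try case: ifP => /=; rewrite ?xpair_eqE /=; lia.
Qed.

Lemma K_W1 f e : inW1 f -> black e ->
  K f e = (e == (f.1, f.2 + 1))%:R + (e == (f.1 - 1, f.2))%:R
          - (e == (f.1, f.2 - 1))%:R - (e == (f.1 + 1, f.2))%:R.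
Proof.
move=> x0 be; rewrite K_W1E // -addrA -opprD.
by congr (_ - _); apply: natb_add;
  case: f e x0 be => [a b] [c d]; pts; try case: ifP => /=; rewrite ?xpair_eqE /=; lia.
Qed.

Lemma fp_W1 e : black e -> inW1 (fp e).
Proof. case: e => a b; pts; case: ifP => /=; lia. Qed.
Lemma fm_W1 e : black e -> inW1 (fm e).
Proof. case: e => a b; pts; case: ifP => /=; lia. Qed.
Lemma fpm e : fp e != fm e.
Proof. case: e => a b; pts; case: ifP => /=; rewrite xpair_eqE; lia. Qed.
Lemma epm e : ep e != em e.
Proof. case: e => a b; pts; case: ifP => /=; rewrite xpair_eqE; lia. Qed.

Section Sums.
Variable R : pzRingType.
Implicit Types z h : pt -> R.

(** The rows of [K] at a vertex and at a face, applied to a function on edges ([sumK_W0],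
    [sumK_W1]), but written on the whole lattice without an ambient list of edges. *)
Definition divg z (x : pt) : R :=
  z (x.1 - 1, x.2) + z (x.1, x.2 - 1) - z (x.1 + 1, x.2) - z (x.1, x.2 + 1).
Definition curl z (f : pt) : R :=
  z (f.1, f.2 + 1) + z (f.1 - 1, f.2) - z (f.1, f.2 - 1) - z (f.1 + 1, f.2).

(** The point [p] may lie outside [E] provided [z] vanishes there; sums over all neighbours of a
    point then need no case distinction at the boundary. *)
Lemma sum_delta (E : seq pt) z (p : pt) : uniq E -> (p \notin E -> z p = 0) ->
  \sum_(e <- E) (e == p)%:R * z e = z p.
Proof.
move=> uE zp; have [pE|/zp zp0] := boolP (p \in E); last first.
  rewrite zp0 big1 // => e _; case: eqP => [->|_]; last by rewrite mul0r.
  by rewrite zp0 mulr0.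
rewrite (bigD1_seq p) //= eqxx mul1r big1 ?addr0 // => e /negPf->.
by rewrite mul0r.
Qed.

Lemma intrB4 (a b c d : bool) :
  ((a%:R + b%:R - c%:R - d%:R : int)%:~R : R) = a%:R + b%:R - c%:R - d%:R.
Proof. by rewrite !(intrB, intrD) !natz -!pmulrn. Qed.

Lemma sumK_W0 (E : seq pt) z x : uniq E -> {in E, forall e : pt, black e} ->
  (forall e : pt, e \notin E -> z e = 0) -> inW0 x ->
  \sum_(e <- E) (K x e)%:~R * z e = divg z x.
Proof.
move=> uE bE zE x0; rewrite big_seq.
under eq_bigr => e eE do rewrite (K_W0 x0 (bE _ eE)) intrB4 !(mulrDl, mulNr).
by rewrite -big_seq !big_split /= !sumrN !sum_delta // => *; exact: zE.
Qed.

Lemma sumK_W1 (E : seq pt) z f : uniq E -> {in E, forall e : pt, black e} ->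
  (forall e : pt, e \notin E -> z e = 0) -> inW1 f ->
  \sum_(e <- E) (K f e)%:~R * z e = curl z f.
Proof.
move=> uE bE zE x0; rewrite big_seq.
under eq_bigr => e eE do rewrite (K_W1 x0 (bE _ eE)) intrB4 !(mulrDl, mulNr).
by rewrite -big_seq !big_split /= !sumrN !sum_delta // => *; exact: zE.
Qed.

End Sums.

Lemma bounded_right (F : seq pt) : exists B : int, forall f : pt, f \in F -> f.1 < B.
Proof.
elim: F => [|g F [B IH]]; first by exists 0.
exists (`|B| + `|g.1| + 1) => f; rewrite inE => /orP[/eqP->|/IH]; lia.
Qed.

Definition rt (f : pt) : pt := (f.1 + 2, f.2).

(** Induction along horizontal rows, starting at their right ends; it terminates because the finite
    set [F] is bounded on the right. *)
Lemma right_ind (F : seq pt) (P : pt -> Prop) :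
  (forall f : pt, f \in F -> (rt f \in F -> P (rt f)) -> P f) ->
  forall f : pt, f \in F -> P f.
Proof.
have [B FB] := bounded_right F; move=> H f.
have [n] := ubnP (absz (B - f.1)%R); elim: n f => // n IH f ltn fF.
apply: H => // rF; apply: IH => //; move: (FB _ rF) (FB _ fF) ltn; rewrite /rt /=; lia.
Qed.

(** This normalisation removes the additive constant of a primitive. Vanishing on a right half-plane
    is what summation along rays to the right gives directly. *)
Definition fin_right (R : nmodType) (h : pt -> R) :=
  exists B : int, forall c : pt, B <= c.1 -> h c = 0.

Lemma vanish_right (R : nmodType) (h : pt -> R) (Q : pt -> Prop) :
  fin_right h -> (forall c, Q c -> Q (rt c)) ->
  (forall c, Q c -> h c = h (rt c)) -> forall c, Q c -> h c = 0.
Proof.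
move=> [B hB] Qr H c; have [n] := ubnP (absz (B + 1 - c.1)%R).
elim: n c => // n IH c ltn Qc; have [|ltB] := boolP (B <= c.1); first exact: hB.
rewrite H //; apply: IH; last exact: Qr.
move: ltn ltB; rewrite /rt /=; move: c.1 => d; lia.
Qed.

(* [g] sums [z] along rays to the right. *)
Lemma poincare (R : comNzRingType) (E : seq pt) (z : pt -> R) :
  uniq E -> {in E, forall e : pt, black e} -> (forall e : pt, e \notin E -> z e = 0) ->
  (forall x, inW0 x -> divg z x = 0) ->
  exists g : pt -> R, fin_right g /\
    forall e, black e -> z e = g (fp e) - g (fm e).
Proof.
move=> uE bE zE dz.
pose g (f : pt) := - \sum_(e <- E | (e.2 == f.2) && (f.1 < e.1)) z e.
have [B EB] := bounded_right E.
have gB c : B <= c.1 -> g c = 0.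
  move=> leB; rewrite /g big_seq_cond big1 ?oppr0 // => e /andP[/EB eB /andP[_ ce]].
  move: eB ce leB; move: (e : pt) (c : pt) => [? ?] [? ?] /=; lia.
(* A vertical edge separates two consecutive faces of a row, whose ray sums differ by the single
   term [z e]. *)
have gv e : black e -> ~~ oddz e.1 -> z e = g (e.1 + 1, e.2) - g (e.1 - 1, e.2).
  move=> be ve; rewrite /g /= opprK addrC.
  rewrite [X in _ = X - _](bigID (fun e' => e' == e)) /=.
  have -> : \sum_(i <- E | (i.2 == e.2) && (e.1 - 1 < i.1) && (i == e)) z i = z e.
    have [eE|eE] := boolP (e \in E).
      rewrite -(sum_delta uE (p := e) (z := z)) ?eE // big_mkcond /=.
      apply: eq_bigr => i _; case: (i =P e) => [->|]; last by rewrite !andbF mul0r.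
      rewrite mul1r eqxx /=; case: ifP => //; lia.
    rewrite zE // big_seq_cond big1 // => i /andP[iE /andP[_ /eqP ie]].
    by move: iE; rewrite ie (negPf eE).
  rewrite -addrA [X in _ + (X - _)](_ : _ = \sum_(e0 <- E | (e0.2 == e.2) && (e.1 + 1 < e0.1)) z e0) ?subrr ?addr0 //.
  rewrite big_seq_cond [RHS]big_seq_cond; apply: eq_bigl => i.
  case iE: (i \in E) => //=; move: (bE _ iE) be ve; case: e => a b; case: i {iE} => c d.
  by pts; lia.
exists g; split; first by exists B.
move=> e be; rewrite /fp /fm; case: ifPn => he; last exact: gv.
(* For a horizontal edge, the defect [w] does not change when the edge moves one place to the right,
   because the divergence vanishes at the vertex passed; far to the right it is zero. *)
pose w (e : pt) := z e - (g (e.1, e.2 - 1) - g (e.1, e.2 + 1)).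
apply/eqP; rewrite -subr_eq0; apply/eqP.
apply: (@vanish_right _ w (fun e => black e && oddz e.1)); last by apply/andP.
- exists B => c leB; rewrite /w !gB // zE ?subrr ?subr0 //.
  by apply/negP => /EB; lia.
- by case=> a b; rewrite /rt; ptl.
case=> a b /andP[bc oc].
have x0 : inW0 (a + 1, b) by move: bc oc; ptl.
have := dz _ x0; rewrite /divg /=.
rewrite (gv (a + 1, b - 1)); [|by move: bc oc; ptl..].
rewrite (gv (a + 1, b + 1)); [|by move: bc oc; ptl..].
rewrite /w /rt /= !addrK -!addrA -(_ : 2 = 1 + 1) // => dz0.
apply/eqP; rewrite -subr_eq0; apply/eqP; rewrite -dz0; ring.
Qed.

Ltac ptcase := case: ifP => /=; rewrite ?xpair_eqE /=.

Lemma mem_mids c e : inW1 c -> (e \in mids c) = black e && ((fp e == c) || (fm e == c)).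
Proof. by case: c e => [a b] [c d]; pts; ptcase; lia. Qed.

Lemma mem_corners c x : (x \in corners c) = (c \in corners x).
Proof. by case: c x => [a b] [c d]; pts; lia. Qed.

(** * The cell complex spanned by a finite set of faces *)

Section Complex.
Variable F : seq pt.
Hypothesis F1 : all inW1 F.

Lemma mem_Mids e : (e \in Mids F) = black e && ((fp e \in F) || (fm e \in F)).
Proof.
apply/flatten_mapP/andP => [[c cF]|[be /orP[] eF]].
- rewrite mem_mids ?(allP F1) // => /andP[-> /orP[]/eqP->]; rewrite cF ?orbT //.
- by exists (fp e); rewrite // mem_mids ?(allP F1) // be eqxx.
- by exists (fm e); rewrite // mem_mids ?(allP F1) // be eqxx orbT.
Qed.

Lemma mem_VH x : (x \in VH F) = has (fun c => c \in F) (corners x).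
Proof.
apply/flatten_mapP/hasP => [[c cF]|[c ? cF]]; exists c => //.
- by rewrite mem_corners.
- by rewrite mem_corners.
Qed.

Lemma VH_W0 x : x \in VH F -> inW0 x.
Proof.
case/flatten_mapP => c /(allP F1).
by case: c x => [a b] [c d]; pts; lia.
Qed.

Lemma Mids_black e : e \in Mids F -> black e.
Proof. by rewrite mem_Mids => /andP[]. Qed.

Lemma ep_VH e : e \in Mids F -> ep e \in VH F.
Proof.
rewrite mem_Mids mem_VH => /andP[be /orP[] eF]; apply/hasP;
  [exists (fp e) | exists (fm e)] => //;
  by case: e be {eF} => a b; pts; ptcase; lia.
Qed.

Lemma em_VH e : e \in Mids F -> em e \in VH F.
Proof.
rewrite mem_Mids mem_VH => /andP[be /orP[] eF]; apply/hasP;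
  [exists (fp e) | exists (fm e)] => //;
  by case: e be {eF} => a b; pts; ptcase; lia.
Qed.

(* A form of connectedness of the complement of [F] that is convenient for counting:
   with [poincare], it says that every cycle of the 1-skeleton bounds faces of [F]. *)
Definition exact_faces := forall h : pt -> rat, fin_right h ->
  (forall e, black e -> fp e \notin F -> fm e \notin F -> h (fp e) = h (fm e)) ->
  forall c, inW1 c -> c \notin F -> h c = 0.

(** Connectedness of the 1-skeleton in the form of an induction principle, so that no explicit paths
    are handled; the equivalence makes the orientation of edges irrelevant. *)
Definition skel_conn := forall (P : pt -> Prop) x0, x0 \in VH F -> P x0 ->
  (forall e, e \in Mids F -> P (ep e) <-> P (em e)) ->
  forall x, x \in VH F -> P x.

Lemma mids_sub f e : f \in F -> e \in mids f -> e \in Mids F.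
Proof. by move=> fF ef; apply/flatten_mapP; exists f. Qed.

(** All four edges of a face of [F] belong to [Mids F], so [phi] may be arbitrary elsewhere: cutting
    it off outside [Mids F] leaves the curl at [f] unchanged. *)
Lemma sumK_face (R : pzRingType) (phi : pt -> R) f : f \in F ->
  \sum_(e <- undup (Mids F)) (K f e)%:~R * phi e = curl phi f.
Proof.
move=> fF; have f1 := allP F1 _ fF.
pose z e := if e \in undup (Mids F) then phi e else 0.
have -> : curl phi f = curl z f.
  have zE e : e \in mids f -> z e = phi e by rewrite /z mem_undup => /(mids_sub fF)->.
  by rewrite /curl !zE //; case: f {fF f1 zE} => a b; pts; lia.
rewrite -(sumK_W1 (E := undup (Mids F))) ?undup_uniq //.
- by rewrite big_seq [RHS]big_seq; apply: eq_bigr => e eE; rewrite /z eE.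
- by move=> e; rewrite mem_undup; exact: Mids_black.
- by move=> e /negPf eE; rewrite /z eE.
Qed.

Lemma boundary_VH e : e \in Mids F -> \sum_(x <- undup (VH F)) K x e = 0.
Proof.
move=> eM; rewrite big_seq.
under eq_bigr => x xV do
  rewrite K_W0E ?(Mids_black eM) ?VH_W0 -1?mem_undup // -[_%:R]mulr1 -[X in _ - X]mulr1.
rewrite -big_seq sumrB (sum_delta (z := fun=> 1)) ?(sum_delta (z := fun=> 1)) ?subrr ?undup_uniq //.
- by rewrite mem_undup em_VH.
- by rewrite mem_undup ep_VH.
Qed.

End Complex.

Lemma mids_black f : inW1 f -> [/\ black (f.1, f.2 + 1), black (f.1 - 1, f.2),
  black (f.1, f.2 - 1) & black (f.1 + 1, f.2)].
Proof. by case: f => a b f1; split; move: f1; ptl. Qed.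

(** The boundary of a boundary is zero: the two edges of a face that meet at one of its corners
    contribute opposite signs. *)
Lemma curlK_W0 x f : inW0 x -> inW1 f -> curl (K x) f = 0.
Proof.
case: f => c d x0 f1; have [b1 b2 b3 b4] := mids_black f1; rewrite /curl !K_W0E //=.
have [-> ->] : ep (c, d + 1) = (c + 1, d + 1) /\ em (c, d + 1) = (c - 1, d + 1).
  by move: f1; pts => ?; case: ifP; split; try apply: pt_eqP; lia.
have [-> ->] : ep (c - 1, d) = (c - 1, d + 1) /\ em (c - 1, d) = (c - 1, d - 1).
  by move: f1; pts => ?; case: ifP; split; try apply: pt_eqP; lia.
have [-> ->] : ep (c, d - 1) = (c + 1, d - 1) /\ em (c, d - 1) = (c - 1, d - 1).
  by move: f1; pts => ?; case: ifP; split; try apply: pt_eqP; lia.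
have [-> ->] : ep (c + 1, d) = (c + 1, d + 1) /\ em (c + 1, d) = (c + 1, d - 1).
  by move: f1; pts => ?; case: ifP; split; try apply: pt_eqP; lia.
by rewrite /=; ring.
Qed.

(** These are the entries of [C C^T]: a face has four edges, and an edge shared by two faces carries
    opposite signs in their rows. The result is the negative Laplacian. *)
Lemma curlK_W1 a f : inW1 a -> inW1 f ->
  curl (K a) f = if a == f then 4 else if lam_adj a f then -1 else 0.
Proof.
case: f => c d a1 f1; have [b1 b2 b3 b4] := mids_black f1; rewrite /curl !K_W1E //=.
have [-> ->] : fp (c, d + 1) = (c, d) /\ fm (c, d + 1) = (c, d + 2).
  by move: f1; pts => ?; case: ifP; split; try apply: pt_eqP; lia.
have [-> ->] : fp (c - 1, d) = (c, d) /\ fm (c - 1, d) = (c - 2, d).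
  by move: f1; pts => ?; case: ifP; split; try apply: pt_eqP; lia.
have [-> ->] : fp (c, d - 1) = (c, d - 2) /\ fm (c, d - 1) = (c, d).
  by move: f1; pts => ?; case: ifP; split; try apply: pt_eqP; lia.
have [-> ->] : fp (c + 1, d) = (c + 2, d) /\ fm (c + 1, d) = (c, d).
  by move: f1; pts => ?; case: ifP; split; try apply: pt_eqP; lia.
case: a {a1} => x y.
have -> : lam_adj (x, y) (c, d) = [|| (x, y) == (c + 2, d), (x, y) == (c - 2, d),
   (x, y) == (c, d + 2) | (x, y) == (c, d - 2)].
  rewrite /lam_adj /dvec !inE !xpair_eqE /= !subr_eq !add0r.
  by rewrite [2 + c]addrC [2 + d]addrC ![-2 + _]addrC.
have [[-> ->]|_] := (x, y) =P (c, d).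
  have neq2 (u : int) : (u == u + 2) = false /\ (u == u - 2) = false by lia.
  by rewrite !xpair_eqE !(neq2 c).1 !(neq2 c).2 !(neq2 d).1 !(neq2 d).2 !andbF.
(* The four neighbours are distinct, so at most one of the four tests succeeds; what remains is a
   finite Boolean check. *)
have nx p q : p != q -> ((x, y) == p) ==> ((x, y) != q) by move=> npq; apply/implyP => /eqP->.
have n1 : (c, d + 2) != (c - 2, d) by rewrite xpair_eqE; lia.
have n2 : (c, d + 2) != (c, d - 2) by rewrite xpair_eqE; lia.
have n3 : (c, d + 2) != (c + 2, d) by rewrite xpair_eqE; lia.
have n4 : (c - 2, d) != (c, d - 2) by rewrite xpair_eqE; lia.
have n5 : (c - 2, d) != (c + 2, d) by rewrite xpair_eqE; lia.
have n6 : (c, d - 2) != (c + 2, d) by rewrite xpair_eqE; lia.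
move: (nx _ _ n1) (nx _ _ n2) (nx _ _ n3) (nx _ _ n4) (nx _ _ n5) (nx _ _ n6).
by do 4!move: (_ == _) => [].
Qed.

(** * Topology of finite unions of faces *)

Lemma conn_ind (adj : rel pt) (S : pred pt) (Q : pt -> Prop) :
  connected_in adj S ->
  (forall a b, S a -> S b -> adj a b -> Q a -> Q b) ->
  forall x y, S x -> S y -> Q x -> Q y.
Proof.
move=> cS step x y Sx Sy; have [p [pp <- Sp]] := cS x y Sx Sy.
elim: p x Sx pp Sp => //= a p IH x Sx /andP[xa pa] /andP[Sa Sp] Qx.
by apply: IH => //; apply: step xa Qx.
Qed.

Lemma lam_mid a b : inW1 a -> lam_adj a b -> exists e, black e /\
  ((fp e = a /\ fm e = b) \/ (fp e = b /\ fm e = a)).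
Proof.
case: a b => [a1 a2] [b1 b2] a0.
rewrite /lam_adj /dvec !inE !xpair_eqE /= => /or4P[]/andP[] /eqP h1 /eqP h2.
- exists (a1 - 1, a2); split; first by move: a0; ptl.
  by left; move: a0; pts => a0; case: ifP; split; try apply: pt_eqP; lia.
- exists (a1 + 1, a2); split; first by move: a0; ptl.
  by right; move: a0; pts => a0; case: ifP; split; try apply: pt_eqP; lia.
- exists (a1, a2 - 1); split; first by move: a0; ptl.
  by right; move: a0; pts => a0; case: ifP; split; try apply: pt_eqP; lia.
- exists (a1, a2 + 1); split; first by move: a0; ptl.
  by left; move: a0; pts => a0; case: ifP; split; try apply: pt_eqP; lia.
Qed.

Lemma mid_ends f : inW1 f ->
  [/\ ep (f.1, f.2 + 1) = (f.1 + 1, f.2 + 1) /\ em (f.1, f.2 + 1) = (f.1 - 1, f.2 + 1),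
      ep (f.1 - 1, f.2) = (f.1 - 1, f.2 + 1) /\ em (f.1 - 1, f.2) = (f.1 - 1, f.2 - 1),
      ep (f.1, f.2 - 1) = (f.1 + 1, f.2 - 1) /\ em (f.1, f.2 - 1) = (f.1 - 1, f.2 - 1) &
      ep (f.1 + 1, f.2) = (f.1 + 1, f.2 + 1) /\ em (f.1 + 1, f.2) = (f.1 + 1, f.2 - 1)].
Proof.
by case: f => a b; pts => f1; split; ptcase; split; try apply: pt_eqP; lia.
Qed.

Section Topology.
Variable F : seq pt.
Hypothesis F1 : all inW1 F.

(** A path outside [F] crosses only edges across which [h] does not jump, and it can be led to a
    face in the half-plane where [h] vanishes. *)
Lemma sc_exact : connected_in lam_adj (fun c => inW1 c && (c \notin F)) ->
  exact_faces F.
Proof.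
move=> cF h [B hB] hE c c1 cF0; have [B' FB'] := bounded_right F.
pose far : pt := (2 * (`|B| + `|B'|) + 1, 1).
have hfar : h far = 0 by apply: hB; rewrite /far /=; lia.
have farF : far \notin F by apply/negP => /FB'; rewrite /far /=; lia.
rewrite -hfar; symmetry.
apply: (@conn_ind _ _ (fun a => h far = h a) cF _ far c) => //.
- move=> a b /andP[a1 aF] /andP[b1 bF] /(lam_mid a1)[e [be H]] ->.
  by case: H aF bF => [][<- <-] ? ?; [|symmetry]; apply: hE.
- by rewrite farF andbT /far; ptl.
- by rewrite c1.
Qed.

(** The edges of a face link its corners, and consecutive faces of a path in the king graph share a
    corner. *)
Lemma sc_skel : connected_in king_adj (fun c => c \in F) -> skel_conn F.
Proof.
move=> cF P x0 x0V Px0 HP x xV.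
(* The upper right corner serves as representative of its face. *)
have walk f y : f \in F -> y \in corners f -> P y <-> P (f.1 + 1, f.2 + 1).
  move=> fF; have f1 := allP F1 _ fF; have [e1 e2 e3 e4] := mid_ends f1.
  have h1 : P (f.1 + 1, f.2 + 1) <-> P (f.1 - 1, f.2 + 1).
    rewrite -{1}e1.1 -e1.2; apply/HP/(mids_sub fF).
    by case: f f1 {fF e1 e2 e3 e4} => a b; ptl.
  have h2 : P (f.1 - 1, f.2 + 1) <-> P (f.1 - 1, f.2 - 1).
    rewrite -{1}e2.1 -e2.2; apply/HP/(mids_sub fF).
    by case: f f1 {fF e1 e2 e3 e4 h1} => a b; ptl.
  have h3 : P (f.1 + 1, f.2 - 1) <-> P (f.1 - 1, f.2 - 1).
    rewrite -{1}e3.1 -e3.2; apply/HP/(mids_sub fF).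
    by case: f f1 {fF e1 e2 e3 e4 h1 h2} => a b; ptl.
  rewrite !inE => /or4P[] /eqP ->; rewrite /shift /= //; tauto.
have [f fF xf] := flatten_mapP xV; have [g gF x0g] := flatten_mapP x0V.
apply/(walk _ _ fF xf); move: Px0 => /(walk _ _ gF x0g).
apply: (@conn_ind _ _ (fun f => P (f.1 + 1, f.2 + 1)) cF) => // a b aF bF adj.
suff [y ya yb] : exists2 y, y \in corners a & y \in corners b.
  by move=> /(walk _ _ aF ya)/(walk _ _ bF yb).
case: a b adj {aF bF} => [a1 a2] [b1 b2]; rewrite /king_adj /dvec /king_steps /lam_steps.
rewrite mem_cat 8!inE !xpair_eqE /= => adj.
(* For coordinates that agree or differ by two, [near] is at distance one from both; applied to both
   coordinates it gives a common corner. *)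
pose near (u v : int) := if u == v then u + 1 else if v < u then u - 1 else u + 1.
have nearP u v : [|| u == v, u == v + 2 | u == v - 2] ->
    ((near u v == u + 1) || (near u v == u - 1)) && ((near u v == v + 1) || (near u v == v - 1)).
  by rewrite /near; case: eqP => [->|]; [lia|case: ifP; lia].
have corn u1 u2 v1 v2 : ((v1 == u1 + 1) || (v1 == u1 - 1)) ->
    ((v2 == u2 + 1) || (v2 == u2 - 1)) -> (v1, v2) \in corners (u1, u2).
  rewrite /corners /diag_steps /shift /= !inE !xpair_eqE.
  by case/orP => -> /orP[] ->; rewrite ?orbT.
have [|h1 h1'] := andP (nearP a1 b1 _); first by lia.
have [|h2 h2'] := andP (nearP a2 b2 _); first by lia.
by exists (near a1 b1, near a2 b2); apply: corn.
Qed.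

End Topology.

(** * Euler formula *)

Lemma sum_fc (R : nmodType) (s : seq pt) (phi : pt -> R) :
  \sum_(j < size s) phi (fc s j) = \sum_(e <- s) phi e.
Proof. by rewrite (big_nth (0, 0)) big_mkord. Qed.

Lemma fc_mem (s : seq pt) (j : 'I_(size s)) : fc s j \in s.
Proof. exact: mem_nth. Qed.

Lemma fc_index (s : seq pt) x : x \in s -> fc s (index x s) = x.
Proof. exact: nth_index. Qed.

Lemma fc_inj (s : seq pt) (i j : 'I_(size s)) : uniq s -> (fc s i == fc s j) = (i == j).
Proof. by move=> us; rewrite nth_uniq. Qed.

(** Passage from vectors indexed by positions in a list to functions on the plane extended by zero,
    for which [divg], [curl] and [nbr_sum] make sense everywhere. *)
Lemma vec_fun (R : nmodType) (s : seq pt) (u : 'I_(size s) -> R) : uniq s ->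
  exists z : pt -> R, (forall e, e \notin s -> z e = 0) /\ forall j : 'I_(size s), z (fc s j) = u j.
Proof.
move=> us; exists (fun e => \sum_(j < size s | fc s j == e) u j); split=> [e|j].
  by move=> ne; rewrite big1 // => j /eqP je; rewrite -je fc_mem in ne.
by rewrite (big_pred1 j) // => i; rewrite fc_inj.
Qed.

Lemma divgD (R : comPzRingType) (z1 z2 : pt -> R) a x :
  divg (fun e => z1 e + a * z2 e) x = divg z1 x + a * divg z2 x.
Proof. rewrite /divg; ring. Qed.

Lemma curlD (R : comPzRingType) (z1 z2 : pt -> R) a x :
  curl (fun e => z1 e + a * z2 e) x = curl z1 x + a * curl z2 x.
Proof. rewrite /curl; ring. Qed.

Lemma divg_delta e x : black e -> inW0 x ->
  divg (fun e' => (e' == e)%:R) x = (x == ep e)%:R - (x == em e)%:R :> int.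
Proof.
move=> be x0; rewrite -K_W0E // -(sumK_W0 (E := [:: e])) //.
- by rewrite big_seq1 eqxx mulr1 intz.
- by move=> e'; rewrite inE => /eqP->.
- by move=> e'; rewrite inE => /negPf->.
Qed.

Lemma curl_delta e f : black e -> inW1 f ->
  curl (fun e' => (e' == e)%:R) f = (f == fp e)%:R - (f == fm e)%:R :> int.
Proof.
move=> be f1; rewrite -K_W1E // -(sumK_W1 (E := [:: e])) //.
- by rewrite big_seq1 eqxx mulr1 intz.
- by move=> e'; rewrite inE => /eqP->.
- by move=> e'; rewrite inE => /negPf->.
Qed.

(** * Integral flows and dual paths *)

Section Inverses.
Variable F : seq pt.
Hypothesis F1 : all inW1 F.

(** A unit flow between [x0] and [x], obtained by adding or removing one edge at a time along the
    skeleton; these flows are the columns of a right inverse of [D]. *)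
Lemma flow_exists x0 : skel_conn F -> x0 \in VH F -> forall x, x \in VH F ->
  exists r : pt -> int, (forall e, e \notin Mids F -> r e = 0) /\
    forall y, inW0 y -> divg r y = (y == x)%:R - (y == x0)%:R.
Proof.
move=> cF x0V; apply: (cF _ x0) => //.
  exists (fun=> 0); split=> // y _; rewrite subrr /divg; ring.
move=> e eM; have be := Mids_black F1 eM.
have nE (r : pt -> int) a : (forall e, e \notin Mids F -> r e = 0) ->
    forall e', e' \notin Mids F -> r e' + a * (e' == e)%:R = 0.
  move=> rE e' e'M; rewrite rE // add0r; case: eqP => [ee|_]; last by rewrite mulr0.
  by move: e'M; rewrite ee eM.
split=> [][r [rE Hr]].
- exists (fun e' => r e' + (-1) * (e' == e)%:R); split; first exact: nE.
  by move=> y y0; rewrite divgD Hr // divg_delta //; ring.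
- exists (fun e' => r e' + 1 * (e' == e)%:R); split; first exact: nE.
  by move=> y y0; rewrite divgD Hr // divg_delta //; ring.
Qed.

(* [s] is the dual path leaving [f] to the right until it exits [F]. *)
Lemma coflow_exists f : f \in F ->
  exists s : pt -> int, forall g, g \in F -> curl s g = (g == f)%:R.
Proof.
move: f; apply: right_ind => f fF IH; have f1 := allP F1 _ fF.
have [_ _ _ be] := mids_black f1.
have [fpe fme] : fp (f.1 + 1, f.2) = rt f /\ fm (f.1 + 1, f.2) = f.
  by case: f f1 {IH fF be} => a b; rewrite /rt; pts => f1; case: ifP;
    split; try apply: pt_eqP; lia.
have [rF|rF] := boolP (rt f \in F).
  have [s Hs] := IH rF.
  exists (fun e => s e + (-1) * (e == (f.1 + 1, f.2))%:R) => g gF.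
  by rewrite curlD Hs // curl_delta ?(allP F1) // fpe fme; ring.
exists (fun e => 0 + (-1) * (e == (f.1 + 1, f.2))%:R) => g gF.
rewrite curlD curl_delta ?(allP F1) // fpe fme.
have -> : (g == rt f) = false by apply/eqP => ge; rewrite -ge gF in rF.
by rewrite /curl mulr0n; ring.
Qed.

End Inverses.

(** The dimensions are independent of the lists, since the number of edges is known to be a sum of
    two sizes only through the Euler formula and not by conversion. *)
Definition Kmx (R : pzRingType) m n (s t : seq pt) : 'M[R]_(m, n) :=
  \matrix_(i, j) (K (fc s i) (fc t j))%:~R.


Lemma map_Kmx (R : pzRingType) m n s t : Kmx R m n s t = map_mx intr (Kmx int m n s t).
Proof. by apply/matrixP => i j; rewrite !mxE intz. Qed.

Section Cells.
Variable F : seq pt.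
Hypotheses (uF : uniq F) (F1 : all inW1 F).
Variable x0 : pt.
Hypothesis x0V : x0 \in VH F.
Let E := undup (Mids F).
Let V' := rem x0 (undup (VH F)).
Variable n : nat.
Hypothesis sE : size E = n.

Lemma mem_V' x : (x \in V') = (x != x0) && (x \in VH F).
Proof. by rewrite /V' mem_rem_uniq ?undup_uniq // !inE mem_undup. Qed.

Lemma size_V' : size (undup (VH F)) = (size V').+1.
Proof.
rewrite size_rem ?mem_undup // prednK //.
by move: x0V; rewrite -mem_undup; case: (undup _).
Qed.

Lemma fc_V' (i : 'I_(size V')) : [/\ fc V' i != x0, fc V' i \in VH F & inW0 (fc V' i)].
Proof. by have := fc_mem i; rewrite mem_V' => /andP[-> xV]; rewrite xV (VH_W0 F1 xV). Qed.

Lemma E_black : {in E, forall e : pt, black e}.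
Proof. by move=> e; rewrite mem_undup => /(Mids_black F1). Qed.

Lemma sum_E (R : nmodType) (phi : pt -> R) :
  \sum_(j < n) phi (fc E j) = \sum_(e <- E) phi e.
Proof. by rewrite -sum_fc sE. Qed.

(** The columns are the flows joining [x0] to the other vertices. Their integrality is what later
    yields a determinant of absolute value one, and not merely full rank. *)
Lemma D_right_inverse : skel_conn F ->
  exists X, Kmx int (size V') n V' E *m X = 1%:M.
Proof.
move=> cF.
have /fin_all_exists[r Hr] (i : 'I_(size V')) : exists r : pt -> int,
   (forall e, e \notin Mids F -> r e = 0) /\
   forall y, inW0 y -> divg r y = (y == fc V' i)%:R - (y == x0)%:R.
  by apply: flow_exists => //; have [] := fc_V' i.
exists (\matrix_(j, i) r i (fc E j)); apply/matrixP => i k; rewrite !mxE.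
have [ix iV i0] := fc_V' i; have [rE rd] := Hr k.
under eq_bigr do rewrite !mxE.
rewrite (sum_E (fun e => (K (fc V' i) e)%:~R * r k e)) sumK_W0 ?undup_uniq //.
- by rewrite rd // (negPf ix) subr0 fc_inj // rem_uniq // undup_uniq.
- exact: E_black.
- by move=> e; rewrite mem_undup; exact: rE.
Qed.

Lemma C_right_inverse : exists X, Kmx int (size F) n F E *m X = 1%:M.
Proof.
have /fin_all_exists[s Hs] (i : 'I_(size F)) : exists s : pt -> int,
   forall g, g \in F -> curl s g = (g == fc F i)%:R.
  by apply: coflow_exists => //; exact: fc_mem.
exists (\matrix_(j, i) s i (fc E j)); apply/matrixP => i k; rewrite !mxE.
under eq_bigr do rewrite !mxE.
rewrite (sum_E (fun e => (K (fc F i) e)%:~R * s k e)) (sumK_face F1) ?fc_mem //.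
by rewrite Hs ?fc_mem // fc_inj.
Qed.

Lemma DC_orth : Kmx int (size V') n V' E *m (Kmx int (size F) n F E)^T = 0.
Proof.
apply/matrixP => i k; rewrite !mxE; under eq_bigr do rewrite !mxE mulrC.
rewrite (sum_E (fun e => (K (fc F k) e)%:~R * (K (fc V' i) e)%:~R)) (sumK_face F1) ?fc_mem //.
have [_ _ i0] := fc_V' i; rewrite -[RHS](curlK_W0 i0 (allP F1 _ (fc_mem k))).
by rewrite /curl !intz.
Qed.

Lemma divg_out (R : pzRingType) (z : pt -> R) : (forall e, e \notin E -> z e = 0) ->
   forall x, inW0 x -> x \notin VH F -> divg z x = 0.
Proof.
move=> zE x xW xV; rewrite -(sumK_W0 (E := E)) ?undup_uniq //; last exact: E_black.
rewrite big_seq big1 // => e eE.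
have eM : e \in Mids F by rewrite -mem_undup.
rewrite K_W0E ?E_black //.
have -> : (x == ep e) = false by apply/eqP => xe; rewrite xe ep_VH in xV.
have -> : (x == em e) = false by apply/eqP => xe; rewrite xe em_VH in xV.
by rewrite subrr mul0r.
Qed.

(* The divergences at all vertices add up to zero, so the one at [x0] is redundant. *)
Lemma divg_all (R : pzRingType) (z : pt -> R) : (forall e, e \notin E -> z e = 0) ->
  (forall x, x \in V' -> divg z x = 0) -> forall x, inW0 x -> divg z x = 0.
Proof.
move=> zE zV x xW; have [xV|] := boolP (x \in VH F); last exact: divg_out.
have [xx0|xx0] := eqVneq x x0; last by apply: zV; rewrite mem_V' xx0.
have : \sum_(y <- undup (VH F)) divg z y = 0.
  rewrite big_seq; under eq_bigr => y yV.
    rewrite -(sumK_W0 (E := E)) ?undup_uniq //; last first.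
      by rewrite (VH_W0 F1) // -mem_undup.
      exact: E_black.
    over.
  rewrite -big_seq exchange_big big_seq big1 // => e eE.
  rewrite -mulr_suml -(raddf_sum (intmul 1)) boundary_VH ?mulr0z ?mul0r //.
  by rewrite -mem_undup.
rewrite (bigD1_seq x) ?undup_uniq ?mem_undup //= big_seq_cond big1 ?addr0 //.
by move=> y; rewrite mem_undup => /andP[yV yx]; apply: zV; rewrite mem_V' -xx0 yx.
Qed.

(** A rank count: [D], with one vertex row dropped, and [C] both have free rows, and the Poincare
    lemma identifies the kernel of [D] with the row space of [C]. *)
Lemma euler : skel_conn F -> exact_faces F -> (size (undup (VH F)) + size F)%N = n.+1.
Proof.
move=> cF eF.
pose D := Kmx rat (size V') n V' E; pose C := Kmx rat (size F) n F E.
have rD : \rank D = size V'.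
  have [X DX] := D_right_inverse cF.
  apply/eqP/row_freeP; exists (map_mx intr X).
  by rewrite /D map_Kmx -map_mxM DX map_mx1.
have rC : \rank C = size F.
  have [X CX] := C_right_inverse.
  apply/eqP/row_freeP; exists (map_mx intr X).
  by rewrite /C map_Kmx -map_mxM CX map_mx1.
have DC : D *m C^T = 0.
  by rewrite /D /C !(@map_Kmx rat) matrix.map_trmx -map_mxM DC_orth map_mx0.
suff kD : (kermx D^T :=: C)%MS.
  have := mxrank_ker D^T; rewrite mxrank_tr kD rD rC => ->.
  rewrite size_V' addSn subnKC //; have := rank_leq_col D; by rewrite rD.
apply/eqmxP/andP; split; last first.
  by apply/sub_kermxP; rewrite -[LHS]trmxK trmx_mul trmxK DC trmx0.
apply/row_subP => i; set u := row i _.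
have : D *m u^T = 0.
  by rewrite -[LHS]trmxK trmx_mul trmxK /u -row_mul mulmx_ker row0 trmx0.
move: (u) => {u} u Du.
have [z [zE zu]] : exists z : pt -> rat, (forall e, e \notin E -> z e = 0) /\
    forall j : 'I_n, z (fc E j) = u 0 j.
  have [z [zE zu]] := vec_fun (fun j => u 0 (cast_ord sE j)) (undup_uniq _ : uniq E).
  exists z; split=> // j; have := zu (cast_ord (esym sE) j).
  by rewrite cast_ordKV.
have [] := @poincare _ E z (undup_uniq _) E_black zE.
  apply: divg_all => // x xV.
  have lx : (index x V' < size V')%N by rewrite index_mem.
  have := congr1 (fun A : 'cV_ _ => A (Ordinal lx) 0) Du; rewrite !mxE => <-.
  have xW : inW0 x by move: xV; rewrite mem_V' => /andP[_ /(VH_W0 F1)].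
  rewrite -(sumK_W0 (E := E)) ?undup_uniq //; last exact: E_black.
  rewrite -(sum_E (fun e => (K x e)%:~R * z e)).
  by apply: eq_bigr => j _; rewrite !mxE zu /= fc_index.
move=> g [gB zg].
(* The primitive of a divergence-free function on the edges vanishes off [F], so its values on [F]
   are the coefficients in terms of the rows of [C]. *)
have g0 : forall c, inW1 c -> c \notin F -> g c = 0.
  apply: eF => // e be fpF fmF; apply/eqP; rewrite -subr_eq0 -zg // zE //.
  by rewrite mem_undup mem_Mids // (negPf fpF) (negPf fmF) andbF.
apply/submxP; exists (\row_i g (fc F i)); apply/rowP => j; rewrite !mxE -zu.
have jE : fc E j \in E by rewrite /fc mem_nth // sE.
have bj := E_black jE.
under eq_bigr do rewrite !mxE mulrC.
rewrite (sum_fc _ (fun f => (K f (fc E j))%:~R * g f)) big_seq.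
under eq_bigr => f fF do rewrite K_W1E ?(allP F1) // intrB !natz -!pmulrn mulrBl.
rewrite -big_seq sumrB !sum_delta // ?zg // => fF; apply: g0 => //.
- exact: fm_W1.
- exact: fp_W1.
Qed.

End Cells.

(** * Determinants of functional graphs and of signed matchings *)

Section FunctionalGraph.
Variable n : nat.
Implicit Type phi : rel 'I_n.

(** Cycles of length at least two are encoded as permutations that move points only along [phi].
    Loops are excluded separately, because a permutation cannot tell a loop from a fixed point. *)
Definition acyclic phi := [forall i, ~~ phi i i] &&
  [forall s : 'S_n, [forall i, (s i == i) || phi i (s i)] ==> (s == 1%g)].

Definition graph_mx phi : 'M[int]_n := \matrix_(i, j) ((i == j)%:R - (phi i j)%:R).

Definition functional phi := forall i j j', phi i j -> phi i j' -> j = j'.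

(** Without cycles only the identity contributes to the Leibniz sum. A loop makes a row zero, and
    the indicator of the support of a longer cycle lies in the left kernel. *)
Lemma det_graph phi : functional phi -> \det (graph_mx phi) = (acyclic phi)%:R.
Proof.
move=> fphi; rewrite /acyclic; have [/forallP irr|] := boolP [forall i, ~~ phi i i]; last first.
  rewrite negb_forall => /existsP[i /negPn pii] /=.
  rewrite (expand_det_row _ i) big1 // => j _; rewrite mxE.
  have [<-|/negPf ij] := eqVneq i j; first by rewrite pii subrr mul0r.
  case pij: (phi i j); last by rewrite subrr mul0r.
  by move: ij; rewrite (fphi _ _ _ pii pij) eqxx.
rewrite andTb; set b := [forall s, _]; have [/forallP ac|] := boolP b.
  rewrite /determinant (bigD1 1%g) //= odd_perm1 expr0 mul1r.
  rewrite (eq_bigr (fun=> 1)) ?big1_eq => [|i _]; last first.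
    by rewrite !mxE perm1 eqxx (negPf (irr i)) subr0.
  rewrite big1 ?addr0 // => s s1; have := ac s; rewrite implybE (negPf s1) orbF.
  rewrite negb_forall => /existsP[i]; rewrite negb_or => /andP[si phis].
  by rewrite (bigD1 i) //= !mxE eq_sym (negPf si) (negPf phis) subrr mul0r mulr0.
rewrite /b negb_forall => /existsP[s]; rewrite negb_imply => /andP[/forallP sphi s1].
apply/eqP/det0P; exists (\row_j (s j != j)%:R).
  apply: contra s1 => /eqP/rowP u0; apply/eqP/permP => j; rewrite perm1.
  by have := u0 j; rewrite !mxE; case: eqP.
apply/rowP => j; rewrite !mxE.
under eq_bigr do rewrite !mxE mulrBr.
rewrite sumrB (bigD1 j) //= eqxx mulr1 big1 ?addr0 => [|i /negPf->]; last by rewrite mulr0.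
apply/eqP; rewrite subr_eq0; apply/eqP.
rewrite (bigD1 (s^-1 j)%g) //= permKV.
have -> : (j != (s^-1)%g j) = (s j != j).
  by rewrite (can2_eq (permK s) (permKV s)).
have [sj|sj] := eqVneq (s j) j.
  rewrite mul0r add0r big1 // => i ij.
  have [sii|nsi] := eqVneq (s i) i; first by rewrite mul0r.
  have := sphi i; rewrite (negPf nsi) /= => phis.
  case pij: (phi i j); last by rewrite mulr0.
  by move: ij; rewrite -(fphi _ _ _ phis pij) permK eqxx.
have sj' : s ((s^-1)%g j) != (s^-1)%g j.
  by rewrite permKV -(can2_eq (permK s) (permKV s)).
have := sphi ((s^-1)%g j); rewrite (negPf sj') permKV /= => ->.
rewrite mulr1 big1 ?addr0 // => i ij.
have [sii|nsi] := eqVneq (s i) i; first by rewrite mul0r.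
have := sphi i; rewrite (negPf nsi) /= => phis.
case pij: (phi i j); last by rewrite mulr0.
by move: ij; rewrite -(fphi _ _ _ phis pij) permK eqxx.
Qed.

Lemma acyclic_sub phi phi' : subrel phi' phi -> acyclic phi -> acyclic phi'.
Proof.
move=> sub /andP[/forallP irr /forallP ac]; apply/andP; split.
  by apply/forallP => i; apply: contra (irr i); exact: sub.
apply/forallP => s; apply/implyP => /forallP h; apply: (implyP (ac s)).
by apply/forallP => i; have /orP[->|/sub->] := h i; rewrite ?orbT.
Qed.

(* The determinant is a difference of two acyclicity indicators: with and without the
   edge leaving [v]. *)
Lemma det_graph_root phi v : functional phi ->
  \det (\matrix_(i, j) (((i == j) && (i != v))%:R - (phi i j)%:R) : 'M[int]_n) <= 0.
Proof.
move=> fphi; pose phi0 i j := phi i j && (i != v).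
have fphi0 : functional phi0 by move=> i j j' /andP[p _] /andP[p' _]; exact: fphi p p'.
rewrite (@determinant_multilinear _ _ _ (graph_mx phi) (graph_mx phi0) v 1 (-1)).
- rewrite !det_graph // mul1r mulN1r subr_le0.
  case ac: (acyclic phi); last exact: ler0n.
  by rewrite (@acyclic_sub phi) // => i j /andP[].
- apply/rowP => j; rewrite !mxE eqxx andbF /phi0 eqxx andbF; ring.
- by apply/matrixP => i j; rewrite !mxE [_ == v]eq_sym neq_lift andbT.
- by apply/matrixP => i j; rewrite !mxE /phi0 [_ == v]eq_sym neq_lift !andbT.
Qed.

End FunctionalGraph.

(** * Equality of signs of the terms of a determinant *)

Section Signs.
Variables m n : nat.
Variables (D : 'M[int]_(m, m + n)) (C C' : 'M[int]_(n, m + n)).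
Variable M : 'M[int]_(m + n).
Hypothesis ME : M = col_mx D C'.
Hypothesis M01 : forall i j, M i j * M i j = (M i j != 0)%:R.
Hypothesis DC : D *m C^T = 0.

Definition valid_perm (s : 'S_(m + n)) := [forall i, M i (s i) != 0].
(** The Leibniz term of [s] is kept as a matrix so that it can be multiplied by the same block
    matrix as [M]. *)
Definition term_mx (s : 'S_(m + n)) : 'M[int]_(m + n) :=
  \matrix_(i, j) (M i j * (s i == j)%:R).

Lemma det_term s : \det (term_mx s) = (-1) ^+ s * \prod_i M i (s i).
Proof.
have -> : term_mx s = diag_mx (\row_i M i (s i)) *m perm_mx s.
  apply/matrixP => i j; rewrite mul_diag_mx !mxE.
  by case: eqP => [->|]; rewrite ?mulr1 ?mulr0.
by rewrite det_mulmx det_diag det_perm mulrC; congr (_ * _); apply: eq_bigr => i _; rewrite mxE.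
Qed.

Lemma det_term_sq s : valid_perm s -> \det (term_mx s) * \det (term_mx s) = 1.
Proof.
move=> /forallP vs; rewrite det_term mulrACA -expr2 sqrr_sign mul1r -big_split /= big1 //.
by move=> i _; rewrite M01 vs.
Qed.

(** The sign shared by the dual blocks of all terms. The bound [dual] is weak; strictness will come
    from [Q0]. *)
Variable eta : int.
Hypothesis etaN0 : eta != 0.
Hypothesis primal : forall s, valid_perm s -> \det (D *m (usubmx (term_mx s))^T) = 1.
Hypothesis dual : forall s, valid_perm s -> 0 <= eta * \det (dsubmx (term_mx s) *m C^T).
Hypothesis Q0 : \det (C' *m C^T) != 0.

(** The determinants of [M] and of its term [P] are compared through the common factor [\det B],
    which is nonzero because [\det M * \det B] is. The factor multiplying [\det (term_mx s)] does
    not depend on [s], so all valid terms agree in sign. *)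
Lemma term_sign s : valid_perm s ->
  0 < \det (term_mx s) * (eta * \det M * \det (C' *m C^T)).
Proof.
move=> vs; set P := term_mx s; pose B := row_mx (usubmx P)^T C^T.
have MB : \det M * \det B = \det (C' *m C^T).
  by rewrite -det_mulmx ME mul_col_row DC det_lblock primal // mul1r.
have PB : \det P * \det B = \det (dsubmx P *m C^T).
  rewrite -det_mulmx -{1}[P]vsubmxK mul_col_row.
  have -> : usubmx P *m (usubmx P)^T = 1%:M.
    apply/matrixP => i j; rewrite !mxE (bigD1 (s (lshift n i))) //= !mxE eqxx mulr1.
    rewrite big1 ?addr0 => [|k]; last first.
      by rewrite !mxE eq_sym => /negPf->; rewrite mulr0 mul0r.
    rewrite (inj_eq perm_inj) (inj_eq (@lshift_inj _ _)) [j == i]eq_sym.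
    case: eqP => [<-|]; last by rewrite !mulr0.
    by rewrite mulr1 M01 (forallP vs).
  have -> : dsubmx P *m (usubmx P)^T = 0.
    apply/matrixP => i j; rewrite !mxE big1 // => k _; rewrite !mxE.
    case: eqP => [<-|]; last by rewrite mulr0 mul0r.
    by rewrite (inj_eq perm_inj) eq_lrshift !mulr0.
  by rewrite det_ublock det1 mul1r.
have B0 : \det B != 0.
  by apply: contra Q0; rewrite -MB => /eqP->; rewrite mulr0.
have P0 : \det P != 0.
  by apply/eqP => P0; have := det_term_sq vs; rewrite -/P P0 mul0r.
have M0 : \det M != 0 by apply: contra Q0; rewrite -MB => /eqP->; rewrite mul0r.
have := dual vs; rewrite -/P -PB -MB => dpos.
have -> : \det P * (eta * \det M * (\det M * \det B))
   = (eta * (\det P * \det B)) * (\det M * \det M) by ring.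
rewrite mulr_gt0 //; last by rewrite -expr2 exprn_even_gt0.
by rewrite lt_def dpos !mulf_neq0.
Qed.

(** Every valid term is [1] or [-1], and by [term_sign] its value is the sign of the constant [c],
    so nothing cancels. *)
Lemma card_valid : (#|[set s | valid_perm s]|)%:Z = `|\det M|.
Proof.
pose c := eta * \det M * \det (C' *m C^T).
have tE s : valid_perm s -> \det (term_mx s) = Num.sg c.
  move=> vs; have := term_sign vs; have := det_term_sq vs; rewrite -/c.
  move/eqP; rewrite -expr2 sqrf_eq1 => /orP[]/eqP->.
    by rewrite mul1r => /gtr0_sg->.
  by rewrite mulN1r oppr_gt0 => /ltr0_sg->.
have detM : \det M = Num.sg c * (#|[set s | valid_perm s]|)%:R.
  rewrite /determinant (bigID valid_perm) /= [X in _ + X]big1 ?addr0; last first.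
    move=> s; rewrite negb_forall => /existsP[i /negPn/eqP Mi].
    by rewrite (bigD1 i) //= Mi mul0r mulr0.
  rewrite (eq_bigr (fun=> Num.sg c)) => [|s vs]; last by rewrite -det_term tE.
  by rewrite sumr_const cardsE mulr_natr.
have [/eqP|] := posnP #|[set s | valid_perm s]|.
  by rewrite detM => /eqP->; rewrite mulr0 normr0.
case/card_gt0P => s; rewrite inE => vs.
rewrite detM normrM -(tE s) // normr_nat.
have -> : `|\det (term_mx s)| = 1.
  by have := det_term_sq vs; move/eqP; rewrite -expr2 sqrf_eq1 => /orP[]/eqP->; rewrite ?normrN1 ?normr1.
by rewrite mul1r natz.
Qed.

End Signs.

(* [B = (X | C^T)] is unimodular since [(D; Y^T) B] is unitriangular. *)
Lemma det_col_mx_orth m n (D : 'M[int]_(m, m + n)) (C C' : 'M[int]_(n, m + n)) X Y :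
  D *m X = 1%:M -> C *m Y = 1%:M -> D *m C^T = 0 ->
  `|\det (col_mx D C')| = `|\det (C' *m C^T)|.
Proof.
move=> DX CY DC; pose B := row_mx X C^T.
have uB : \det (col_mx D Y^T) * \det B = 1.
  rewrite -det_mulmx mul_col_row DX DC det_lblock det1 mul1r.
  by rewrite -trmx_mul CY trmx1 det1.
have MB : \det (col_mx D C') * \det B = \det (C' *m C^T).
  by rewrite -det_mulmx mul_col_row DX DC det_lblock det1 mul1r.
have : `|\det B|%N == 1%N.
  by have := congr1 absz uB; rewrite abszM => /eqP; rewrite muln_eq1 => /andP[].
by move/eqP => B1; rewrite -MB normrM -[`|\det B|]abszE B1 mulr1.
Qed.

(** * Acyclicity of the graph of a matching *)

Lemma W01 a : inW0 a -> inW1 a -> False.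
Proof. by case: a => a b; ptl. Qed.

Lemma K_W0_neq0 x e : inW0 x -> black e -> (K x e != 0) = (x == ep e) || (x == em e).
Proof.
move=> x0 be; rewrite K_W0E //; have [->|_] := eqVneq x (ep e); first by rewrite (negPf (epm e)).
by have [_|_] := eqVneq x (em e).
Qed.

Lemma K_W1_neq0 f e : inW1 f -> black e -> (K f e != 0) = (f == fp e) || (f == fm e).
Proof.
move=> x0 be; rewrite K_W1E //; have [->|_] := eqVneq f (fp e); first by rewrite (negPf (fpm e)).
by have [_|_] := eqVneq f (fm e).
Qed.

Lemma ends_corners x e : black e -> (x == ep e) || (x == em e) ->
  (fp e \in corners x) && (fm e \in corners x).
Proof. by case: e x => [a b] [c d]; pts => be /orP[]; ptcase; lia. Qed.

Lemma edge_faces x : inW0 x ->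
  [/\ fp (x.1 + 1, x.2) = (x.1 + 1, x.2 - 1) /\ fm (x.1 + 1, x.2) = (x.1 + 1, x.2 + 1),
      fp (x.1 - 1, x.2) = (x.1 - 1, x.2 - 1) /\ fm (x.1 - 1, x.2) = (x.1 - 1, x.2 + 1),
      fp (x.1, x.2 + 1) = (x.1 + 1, x.2 + 1) /\ fm (x.1, x.2 + 1) = (x.1 - 1, x.2 + 1) &
      fp (x.1, x.2 - 1) = (x.1 + 1, x.2 - 1) /\ fm (x.1, x.2 - 1) = (x.1 - 1, x.2 - 1)].
Proof.
by case: x => a b; pts => f1; split; ptcase; split; try apply: pt_eqP; lia.
Qed.

Lemma star_black x : inW0 x -> [/\ black (x.1 + 1, x.2), black (x.1 - 1, x.2),
  black (x.1, x.2 + 1) & black (x.1, x.2 - 1)].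
Proof. by case: x => a b f1; split; move: f1; ptl. Qed.

Lemma star_ends x : inW0 x -> [/\ em (x.1 + 1, x.2) = x, ep (x.1 - 1, x.2) = x,
  em (x.1, x.2 + 1) = x & ep (x.1, x.2 - 1) = x].
Proof.
by case: x => a b; pts => f1; split; ptcase => ?; try apply: pt_eqP; lia.
Qed.

Lemma ep_right x : inW0 x -> ep (x.1 + 1, x.2) = rt x.
Proof.
by case: x => a b; rewrite /rt; pts => f1; ptcase => ?; try apply: pt_eqP; lia.
Qed.

Lemma right_faces f : inW1 f -> [/\ black (f.1 + 1, f.2),
   fp (f.1 + 1, f.2) = rt f & fm (f.1 + 1, f.2) = f].
Proof.
case: f => a b; rewrite /rt; pts => f1; split; try (ptcase => ?; try apply: pt_eqP; lia).
lia.
Qed.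

Lemma divg_coboundary (h : pt -> rat) (y : pt -> rat) x : inW0 x ->
  (forall e, black e -> y e = h (fp e) - h (fm e)) -> divg y x = 0.
Proof.
move=> x0 Hy; have [b1 b2 b3 b4] := star_black x0; have [e1 e2 e3 e4] := edge_faces x0.
rewrite /divg !Hy // e1.1 e1.2 e2.1 e2.2 e3.1 e3.2 e4.1 e4.2; ring.
Qed.

(** Here [x] and [x'] are the two ends of [e]; multiplication by the sign [K x e] replaces the fixed
    orientation of the edge by the one for which [x] counts positively. *)
Lemma KK_W0 x x' y e : black e -> inW0 x -> inW0 x' -> inW0 y ->
  K x e != 0 -> K x' e != 0 -> x' != x -> K y e * K x e = (y == x)%:R - (y == x')%:R.
Proof.
move=> be x0 x0' y0; rewrite !K_W0_neq0 // !K_W0E //.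
by move=> /orP[] /eqP-> /orP[] /eqP->; rewrite ?eqxx // => nE;
 rewrite ?(negPf (epm _)) ?[em _ == ep _]eq_sym ?(negPf (epm _)) ?mulr1 ?subr0 ?sub0r ?mulrN1 ?opprB.
Qed.

Section NoCycle.
(** [m] sends each white point other than [v] and [w] to its black partner. [Y] lists the vertices
    of a supposed cycle, on which [nx x] is the other end of the edge [m x]; by [nx_orbit] it is a
    single orbit. *)
Variables (F : seq pt) (fs v w : pt) (m nx : pt -> pt) (Y : seq pt) (y0 : pt).
Hypotheses (uF : uniq F) (F1 : all inW1 F) (eF : exact_faces F).
Hypotheses (fs1 : inW1 fs) (vF : v \in fs :: F) (vw : w \in corners v).
Hypothesis mV : forall x, x \in VH F -> x != w -> m x \in Mids F /\ K x (m x) != 0.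
Hypothesis mF : forall f, f \in fs :: F -> f != v -> m f \in Mids F /\ K f (m f) != 0.
Let white_row a := ((a \in VH F) && (a != w)) || ((a \in fs :: F) && (a != v)).
Hypothesis m_inj : forall a b, white_row a -> white_row b -> m a = m b -> a = b.
Hypothesis m_surj : forall e, e \in Mids F -> exists2 a, white_row a & m a = e.
Hypotheses (uY : uniq Y) (y0Y : y0 \in Y).
Hypothesis YV : forall x, x \in Y -> (x \in VH F) && (x != w).
Hypothesis nxY : forall x, x \in Y -> nx x \in Y.
Hypothesis nx_neq : forall x, x \in Y -> nx x != x.
Hypothesis nx_edge : forall x, x \in Y -> K (nx x) (m x) != 0.
Hypothesis nx_inj : {in Y &, injective nx}.
Hypothesis nx_orbit : forall P : pt -> Prop, P y0 ->
  (forall x, x \in Y -> P x -> P (nx x)) -> forall x, x \in Y -> P x.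

Let Y0 x : x \in Y -> inW0 x.
Proof. by move=> /YV/andP[/(VH_W0 F1)]. Qed.

Let mY x : x \in Y -> m x \in Mids F /\ K x (m x) != 0.
Proof. by move=> /YV/andP[xV xw]; apply: mV. Qed.

Let bY x : x \in Y -> black (m x).
Proof. by move=> /mY[/(Mids_black F1)]. Qed.

Let row_Y x : x \in Y -> white_row x.
Proof. by move=> /YV; rewrite /white_row => ->. Qed.

Let KK x y : x \in Y -> inW0 y -> K y (m x) * K x (m x) = (y == x)%:R - (y == nx x)%:R.
Proof.
move=> xY yW; have [_ Kx] := mY xY.
exact: KK_W0 (bY xY) (Y0 xY) (Y0 (nxY xY)) yW Kx (nx_edge xY) (nx_neq xY).
Qed.

(** The cycle as an oriented 1-chain. *)
Let z (e : pt) : rat := \sum_(x <- Y) (K x e)%:~R * (e == m x)%:R.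

Let z_m x : x \in Y -> z (m x) = (K x (m x))%:~R.
Proof.
move=> xY; rewrite /z (bigD1_seq x) //= eqxx mulr1 big_seq_cond big1 ?addr0 // => y /andP[yY yx].
case: eqP => [my|]; last by rewrite mulr0.
by move: yx; rewrite (m_inj (row_Y xY) (row_Y yY) my) eqxx.
Qed.

Let z_out e : e \notin map m Y -> z e = 0.
Proof.
move=> eZ; rewrite /z big_seq big1 // => x xY; case: eqP => [em|]; last by rewrite mulr0.
by move: eZ; rewrite em map_f.
Qed.

Let z_neq0 x : x \in Y -> z (m x) != 0.
Proof. by move=> xY; rewrite z_m // intr_eq0; have [] := mY xY. Qed.

Let divg_Y (c : pt -> rat) (y : pt) : inW0 y ->
  divg (fun e => \sum_(x <- Y) c x * ((K x e)%:~R * (e == m x)%:R)) y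
   = \sum_(x <- Y) c x * ((y == x)%:R - (y == nx x)%:R).
Proof.
move=> yW; rewrite /divg -!big_split /= -!sumrB big_seq [RHS]big_seq; apply: eq_bigr => x xY.
have -> : (y == x)%:R - (y == nx x)%:R = (K y (m x))%:~R * (K x (m x))%:~R :> rat.
  by rewrite -intrM KK // intrB !natz -!pmulrn.
have kz e : (K x e)%:~R * (e == m x)%:R = (K x (m x))%:~R * ((e == m x)%:R : int)%:~R :> rat.
  by rewrite natz -pmulrn; case: eqP => [->|_]; rewrite ?mulr0.
rewrite !kz [K y _]K_W0E ?bY // -divg_delta ?bY // /divg !(intrB, intrD); ring.
Qed.

Let nx_perm : perm_eq (map nx Y) Y.
Proof.
have uN : uniq (map nx Y) by rewrite map_inj_in_uniq.
apply: uniq_perm => //.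
by apply: (uniq_min_size uN _ _).2; rewrite ?size_map // => _ /mapP[x xY ->]; exact: nxY.
Qed.

Let divg_ext (R : pzRingType) (a b : pt -> R) x : a =1 b -> divg a x = divg b x.
Proof. by move=> ab; rewrite /divg !ab. Qed.

Let divg_z y : inW0 y -> divg z y = 0.
Proof.
move=> yW; rewrite -(divg_ext (a := fun e => \sum_(x <- Y) 1 * ((K x e)%:~R * (e == m x)%:R))).
  rewrite (divg_Y (fun=> 1)) // -mulr_sumr mul1r sumrB.
  rewrite -(big_map nx xpredT (fun x => (y == x)%:R)) (perm_big _ nx_perm) /=.
  by rewrite subrr.
by move=> e; rewrite /z; under eq_bigr do rewrite mul1r.
Qed.

Let sum_Y (c : pt -> rat) a : a \in Y -> \sum_(x <- Y) c x * (a == x)%:R = c a.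
Proof.
move=> aY; under eq_bigr do rewrite mulrC eq_sym.
by rewrite sum_delta // aY.
Qed.

(** Zero divergence at [nx x] forces equal coefficients on the two cycle edges meeting there, and
    the cycle is a single orbit. *)
Let cycle_unique (y : pt -> rat) : (forall e, e \notin map m Y -> y e = 0) ->
  (forall x, inW0 x -> divg y x = 0) -> exists c, forall e, y e = c * z e.
Proof.
(* The sign [K x (m x)] is its own inverse, so [c x] is the coefficient of [y] relative to [z] on
   the edge leaving [x]. *)
move=> yZ dy; pose c x := y (m x) * (K x (m x))%:~R.
have KK1 x : x \in Y -> (K x (m x))%:~R * (K x (m x))%:~R = 1 :> rat.
  by move=> xY; rewrite -intrM KK ?Y0 // eqxx eq_sym (negPf (nx_neq xY)).
have yE e : y e = \sum_(x <- Y) c x * ((K x e)%:~R * (e == m x)%:R).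
  have [/mapP[x xY ->]|eZ] := boolP (e \in map m Y); last first.
    rewrite yZ // big_seq big1 // => x xY; case: eqP => [em|]; last by rewrite !mulr0.
    by move: eZ; rewrite em map_f.
  rewrite (bigD1_seq x) //= eqxx mulr1 /c -mulrA KK1 // mulr1.
  rewrite big_seq_cond big1 ?addr0 // => x' /andP[xY' xx'].
  case: eqP => [my|]; last by rewrite !mulr0.
  by move: xx'; rewrite (m_inj (row_Y xY) (row_Y xY') my) eqxx.
have cnx x : x \in Y -> c (nx x) = c x.
  move=> xY; have := dy _ (Y0 (nxY xY)); rewrite (divg_ext _ yE) divg_Y ?Y0 ?nxY //.
  under eq_bigr do rewrite mulrBr; rewrite sumrB sum_Y ?nxY //.
  rewrite [X in _ - X](_ : _ = c x); first by move/eqP; rewrite subr_eq0 => /eqP.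
  rewrite -[RHS](sum_Y c) // big_seq [RHS]big_seq; apply: eq_bigr => x' xY'.
  by rewrite (inj_in_eq nx_inj).
have cc x : x \in Y -> c x = c y0.
  by move: x; apply: nx_orbit => // x xY; rewrite cnx.
exists (c y0) => e; rewrite yE /z mulr_sumr big_seq [RHS]big_seq.
by apply: eq_bigr => x xY; rewrite cc.
Qed.

Lemma no_cycle : False.
Proof.
have [] := @poincare _ (undup (Mids F)) z (undup_uniq _) (E_black F1) _ divg_z.
  move=> e; rewrite mem_undup => eM; apply: z_out; apply/mapP => -[x xY ex].
  by move: eM; rewrite ex; case: (mY xY) => ->.
move=> g [gB zg].
have g0 : forall c, inW1 c -> c \notin F -> g c = 0.
  apply: eF => // e be fpF fmF; apply/eqP; rewrite -subr_eq0 -zg // z_out //.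
  apply/mapP => -[x xY ex]; have [] := mY xY.
  by rewrite -ex mem_Mids // (negPf fpF) (negPf fmF) andbF.
have zgeq e : black e -> e \notin map m Y -> g (fp e) = g (fm e).
  by move=> be eZ; apply/eqP; rewrite -subr_eq0 -zg // z_out.
(* This replaces the Jordan curve theorem. *)
have jordan (h : pt -> rat) : fin_right h ->
    (forall e, black e -> e \notin map m Y -> h (fp e) = h (fm e)) ->
    exists c, forall f, inW1 f -> h f = c * g f.
  move=> [Bh hB] hE; pose y e := if black e then h (fp e) - h (fm e) else 0.
  have yb e : black e -> y e = h (fp e) - h (fm e) by rewrite /y => ->.
  have [e eZ|x x0|c yc] := @cycle_unique y.
  - by rewrite /y; case: ifP => // be; rewrite hE // subrr.
  - exact: divg_coboundary x0 yb.
  exists c => f f1; apply/eqP; rewrite -subr_eq0; apply/eqP.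
  apply: (@vanish_right _ (fun f => h f - c * g f) inW1) f1.
  - have [Bg Bg0] := gB; exists (`|Bh| + `|Bg|) => d dB.
    by rewrite hB ?Bg0 ?mulr0 ?subrr //; move: dB; clear; lia.
  - by move=> d /right_faces[be <- _]; exact: fp_W1.
  move=> d d1; have [be fpe fme] := right_faces d1.
  have := yb _ be; rewrite yc zg // fpe fme => H.
  apply/eqP; rewrite -subr_eq0; apply/eqP.
  have -> : h d - c * g d - (h (rt d) - c * g (rt d)) =
    c * (g (rt d) - g d) - (h (rt d) - h d) by ring.
  by rewrite H subrr.
(* The inside of the cycle. *)
pose Fin := [seq f <- F | g f != 0].
have uFin : uniq Fin by rewrite filter_uniq.
have Fin1 : all inW1 Fin.
  by apply/allP => f; rewrite mem_filter => /andP[_ /(allP F1)].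
have memFin f : inW1 f -> (f \in Fin) = (g f != 0).
  move=> f1; rewrite mem_filter; case: (boolP (f \in F)); first by rewrite andbT.
  by move=> fF; rewrite g0 // eqxx.
have FinF f : f \in Fin -> f \in F by rewrite mem_filter => /andP[].
clearbody Fin.
have MidsFin e : e \in Mids Fin -> e \in Mids F.
  by rewrite !mem_Mids // => /andP[-> /orP[]/FinF->]; rewrite ?orbT.
have VHFin x : x \in VH Fin -> x \in VH F.
  by rewrite !mem_VH => /hasP[c cx /FinF cF]; apply/hasP; exists c.
(* A function without jumps outside [Fin], set to zero on [Fin], jumps only across the cycle; it is
   a multiple of [g], which vanishes outside [Fin]. *)
have exactFin : exact_faces Fin.
  move=> h hB hE c c1 cF.
  have [|e be eZ|k hk] := jordan (fun f => if g f != 0 then 0 else h f).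
  - by case: hB => B hB; exists B => f fB; rewrite hB //; case: ifP.
  - have := zgeq _ be eZ; move=> ge; rewrite ge; case: ifP => // gn0.
    by apply: hE; rewrite // memFin ?fp_W1 ?fm_W1 // ?ge gn0.
  by have := hk c c1; move: cF; rewrite memFin // negbK => /eqP->; rewrite eqxx mulr0.
have ZFin x : x \in Y -> m x \in Mids Fin.
  move=> xY; have := z_neq0 xY; have bm := bY xY; rewrite zg // mem_Mids // bm.
  rewrite !memFin ?fp_W1 ?fm_W1 //; apply: contraR; rewrite negb_or !negbK.
  by case/andP => /eqP-> /eqP->; rewrite subrr.
have incY x y : x \in Y -> inW0 y -> (y == ep (m x)) || (y == em (m x)) -> y \in Y.
  move=> xY y0'; rewrite -K_W0_neq0 ?bY // => Ky; have [_ Kx] := mY xY.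
  have := KK xY y0'; case: eqP => [->//|_]; case: eqP => [->|_]; first by rewrite nxY.
  by move/eqP; rewrite subrr mulf_eq0 (negPf Ky) (negPf Kx).
(* None of the four edges at a vertex off the cycle belongs to the cycle, so [g] is constant on the
   four faces around it. *)
have star x : inW0 x -> x \notin Y -> forall c, c \in corners x ->
    g c = g (x.1 + 1, x.2 + 1).
  move=> x0 xY; have [b1 b2 b3 b4] := star_black x0; have [e1 e2 e3 e4] := edge_faces x0.
  have [s1 s2 s3 s4] := star_ends x0.
  have nZ e : (x == ep e) || (x == em e) -> e \notin map m Y.
    move=> xe; apply/mapP => -[y yY ey]; move: xY; rewrite (incY y) //.
    by rewrite -ey.
  have h1 := zgeq _ b1 (nZ _ _); have h2 := zgeq _ b2 (nZ _ _).
  have h3 := zgeq _ b3 (nZ _ _); have h4 := zgeq _ b4 (nZ _ _).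
  move: h1 h2 h3 h4; rewrite s1 s2 s3 s4 eqxx ?orbT e1.1 e1.2 e2.1 e2.2 e3.1 e3.2 e4.1 e4.2.
  move=> h1 h2 h3 h4 c; rewrite !inE /shift /= => /or4P[]/eqP-> //.
  - by rewrite h2 // h3.
  - by rewrite h1.
  - by rewrite h3.
have star_in x c : x \in VH Fin -> x \notin Y -> c \in corners x -> inW1 c -> c \in Fin.
  move=> xV xY cx c1; have x0 := VH_W0 Fin1 xV.
  move: xV; rewrite mem_VH => /hasP[d dx dF].
  by rewrite memFin // (star x) // -(star x x0 xY d dx) -memFin // (allP Fin1).
(* Vertices of the cycle are linked along it. Any other vertex of [Fin] is surrounded by faces of
   [Fin], so one can move to the right until the cycle is met. *)
have skelFin : skel_conn Fin.
  move=> P x0 x0V Px0 HP.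
  have PY y : y \in Y -> P y0 <-> P y.
    move: y; apply: nx_orbit => // y yY ->.
    have := HP _ (ZFin _ yY); have [_] := mY yY; have := nx_edge yY.
    rewrite !K_W0_neq0 ?bY ?Y0 ?nxY //.
    by move: (m y) (nx y) => e y' /orP[]/eqP-> /orP[]/eqP->; tauto.
  have PX x : x \in VH Fin -> P x <-> P y0.
    move: x; apply: right_ind => x xV IH; have xW := VH_W0 Fin1 xV.
    have [xY|xY] := boolP (x \in Y); first by have := PY _ xY; tauto.
    have [be _ _ _] := star_black xW; have [[_ e2] _ _ _] := edge_faces xW.
    have eM : (x.1 + 1, x.2) \in Mids Fin.
      have cin : (x.1 + 1, x.2 + 1) \in corners x by rewrite inE /shift eqxx.
      have c1 : inW1 (x.1 + 1, x.2 + 1) by rewrite -e2 fm_W1.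
      by rewrite mem_Mids // be e2 (star_in x _ xV xY cin c1) orbT.
    have := HP _ eM; have [-> _ _ _] := star_ends xW; rewrite ep_right // => <-.
    by apply: IH; rewrite -ep_right // ep_VH.
  by move=> x /PX ->; apply/(PX x0).
have y0V : y0 \in VH Fin.
  have [_] := mY y0Y; rewrite K_W0_neq0 ?bY ?Y0 // => /orP[]/eqP->.
    exact/ep_VH/ZFin.
  exact/em_VH/ZFin.
have := euler uFin Fin1 y0V erefl skelFin exactFin.
pose A := [seq x <- undup (VH Fin) | x != w] ++ [seq f <- Fin | f != v].
have rowA a : a \in A -> white_row a.
  rewrite mem_cat !mem_filter mem_undup /white_row => /orP[]/andP[aw aF].
    by rewrite VHFin // aw.
  by rewrite inE (FinF _ aF) aw !orbT.
have uA : uniq A.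
  rewrite cat_uniq !filter_uniq ?undup_uniq // andbT /=; apply/hasPn => f.
  rewrite !mem_filter => /andP[_ fF]; rewrite mem_undup; apply/negP => /andP[_].
  by move=> /(VH_W0 Fin1) /W01 /(_ (allP Fin1 _ fF)).
(* A vertex on the cycle has its partner on the cycle, one off the cycle has only faces of [Fin]
   around it, and a face is matched to one of its own edges. Conversely, an edge of [Fin] matched to
   a face is off the cycle and hence has [Fin] on both sides. *)
have mA : map m A =i undup (Mids Fin).
  move=> e; rewrite mem_undup; apply/mapP/idP => [[a aA ->]|eM].
    move: aA; rewrite mem_cat !mem_filter mem_undup => /orP[/andP[aw aV]|].
      have [aY|aY] := boolP (a \in Y); first exact: ZFin.
      have [ma Ka] := mV (VHFin _ aV) aw; have ba := Mids_black F1 ma.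
      move: Ka; rewrite K_W0_neq0 ?(VH_W0 Fin1) // => /(ends_corners ba)/andP[c1 c2].
      by rewrite mem_Mids // ba (star_in a) // fp_W1.
    move=> /andP[av aFin]; have aF := FinF _ aFin.
    have [] := mF _ av; first by rewrite inE aF orbT.
    move=> ma; have ba := Mids_black F1 ma; rewrite K_W1_neq0 ?(allP F1) // mem_Mids // ba.
    by case/orP => /eqP <-; rewrite aFin ?orbT.
  have [a ra ma] := m_surj (MidsFin _ eM); exists a => //.
  have be := Mids_black Fin1 eM.
  rewrite mem_cat !mem_filter mem_undup; case/orP: (ra) => /andP[aV aw].
    have [_] := mV aV aw; rewrite ma K_W0_neq0 ?(VH_W0 F1) // aw => /orP[]/eqP->.
      by rewrite ep_VH.
    by rewrite em_VH.
  have [_] := mF aV aw; rewrite ma aw /= => Ka; apply/orP; right.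
  have a1 : inW1 a by move: aV; rewrite inE => /orP[/eqP->//|/(allP F1)].
  have eZ : e \notin map m Y.
    apply/mapP => -[x xY ex]; have := m_inj ra (row_Y xY); rewrite ma ex => /(_ erefl) ax.
    by apply: (W01 (Y0 xY)); rewrite -ax.
  have := zgeq _ be eZ => ge.
  have fF : (fp e \in Fin) = (fm e \in Fin) by rewrite !memFin ?fp_W1 ?fm_W1 // ge.
  move: eM; rewrite mem_Mids // be /= fF orbb => fm_in.
  by move: Ka; rewrite K_W1_neq0 // => /orP[]/eqP->; rewrite ?fF.
have umA : uniq (map m A).
  by rewrite map_inj_in_uniq // => a b aA bA; apply: m_inj; exact: rowA.
have <- : size A = size (undup (Mids Fin)).
  by rewrite -(size_map m); apply/perm_size/uniq_perm; rewrite ?undup_uniq.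
have v1 : inW1 v by move: vF; rewrite inE => /orP[/eqP->//|/(allP F1)].
(* Since [w] is not on the cycle, the four faces around it, [v] among them, are all in [Fin] or all
   outside. *)
have wv : (w \in VH Fin) = (v \in Fin).
  apply/idP/idP => [wV|vFin].
    apply: (star_in w) => //; last by rewrite -mem_corners.
    by apply/negP => /YV; rewrite eqxx andbF.
  by apply/flatten_mapP; exists v.
have cnt (s : seq pt) x : uniq s -> size [seq y <- s | y != x] = (size s - (x \in s))%N.
  move=> us; rewrite -rem_filter //; case: (boolP (x \in s)) => xs.
    by rewrite size_rem // subn1.
  by rewrite rem_id // subn0.
rewrite /A size_cat !cnt ?undup_uniq // mem_undup wv.
have : (v \in Fin <= size Fin)%N by case: (boolP (_ \in _)) => //; case: (Fin).
have : (v \in Fin <= size (undup (VH Fin)))%N.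
  by rewrite -wv -mem_undup; case: (boolP (_ \in _)) => //; case: (undup _).
(* Vertices plus faces exceed the edges of [Fin] by one according to Euler, but by [2k] according to
   the matching, with [k] telling whether [v] is in [Fin]. *)
by move: (size Fin) (size _) (v \in Fin) => a b k; clear; case: k; lia.
Qed.

End NoCycle.

(** * The Dirichlet problem on the faces *)

Lemma lam_adj_sym : symmetric lam_adj.
Proof.
by case=> a b [c d]; rewrite /lam_adj /dvec !inE !xpair_eqE /=; lia.
Qed.

Lemma lam_adj_irr f : lam_adj f f = false.
Proof. by case: f => a b; rewrite /lam_adj /dvec !inE !xpair_eqE /= !subrr. Qed.

Definition nbr_sum (z : pt -> rat) (f : pt) : rat :=
  z (f.1 + 2, f.2) + z (f.1 - 2, f.2) + z (f.1, f.2 + 2) + z (f.1, f.2 - 2).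

Lemma lam_adjE a f : lam_adj a f = [|| f == (a.1 + 2, a.2), f == (a.1 - 2, a.2),
  f == (a.1, a.2 + 2) | f == (a.1, a.2 - 2)].
Proof.
by case: a f => [a b] [c d]; rewrite /lam_adj /dvec !inE !xpair_eqE /=; lia.
Qed.

Lemma lam_adj_natE a f : (lam_adj a f)%:R = (f == (a.1 + 2, a.2))%:R +
  (f == (a.1 - 2, a.2))%:R + (f == (a.1, a.2 + 2))%:R + (f == (a.1, a.2 - 2))%:R :> rat.
Proof.
rewrite lam_adjE; case: a => a b /=.
have n1 : (a + 2, b) != (a - 2, b) by rewrite xpair_eqE; lia.
have n2 : (a + 2, b) != (a, b + 2) by rewrite xpair_eqE; lia.
have n3 : (a + 2, b) != (a, b - 2) by rewrite xpair_eqE; lia.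
have n4 : (a - 2, b) != (a, b + 2) by rewrite xpair_eqE; lia.
have n5 : (a - 2, b) != (a, b - 2) by rewrite xpair_eqE; lia.
have n6 : (a, b + 2) != (a, b - 2) by rewrite xpair_eqE; lia.
have nx p q : p != q -> (f == p) ==> (f != q) by move=> npq; apply/implyP => /eqP->.
move: (nx _ _ n1) (nx _ _ n2) (nx _ _ n3) (nx _ _ n4) (nx _ _ n5) (nx _ _ n6).
by do 4!move: (_ == _) => [].
Qed.

Lemma exists_min (F : seq pt) (z : pt -> rat) : F != [::] ->
  exists2 f, f \in F & forall g, g \in F -> z f <= z g.
Proof.
elim: F => // a F IH _; have [->|/IH[f fF fm]] := eqVneq F [::].
  by exists a; rewrite ?inE // => g; rewrite inE => /eqP->.
have [za|za] := lerP (z a) (z f).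
  exists a; rewrite ?inE ?eqxx // => g; rewrite inE => /orP[/eqP->//|/fm].
  exact: le_trans.
exists f; rewrite ?inE ?fF ?orbT // => g; rewrite inE => /orP[/eqP->|/fm//].
exact: ltW.
Qed.

Section Potential.
Variable F : seq pt.
Hypothesis uF : uniq F.

(** At a negative minimum all four neighbours take the same value; following it to the right
    eventually leaves [F], where [z] is zero. *)
Lemma min_principle (z : pt -> rat) : (forall f, f \notin F -> z f = 0) ->
  (forall f, f \in F -> nbr_sum z f <= 4 * z f) -> forall f, 0 <= z f.
Proof.
move=> zF sup f; have [fF|/zF->//] := boolP (f \in F).
have F0 : F != [::] by case: (F) fF.
have [f0 f0F fmin] := exists_min z F0; apply: le_trans (fmin _ fF).
rewrite leNgt; apply/negP => m0.
have mall g : z f0 <= z g.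
  by have [/fmin//|/zF->] := boolP (g \in F); exact: ltW.
suff : forall g, g \in F -> z g = z f0 -> False by move=> /(_ _ f0F erefl).
apply: right_ind => g gF IH gm.
have := sup _ gF; rewrite /nbr_sum gm => le4.
have h1 := mall (g.1 + 2, g.2); have h2 := mall (g.1 - 2, g.2).
have h3 := mall (g.1, g.2 + 2); have h4 := mall (g.1, g.2 - 2).
have rm : z (rt g) = z f0 by rewrite /rt; lra.
apply: (IH _ rm); apply/negPn/negP => /zF rz; move: m0; rewrite -rm rz; lra.
Qed.

(** A zero of the nonnegative function [z] in [F] spreads to its neighbours in [F], and at a face
    adjacent to [fs] it contradicts the equation. Connectedness through [fs] forces one of these
    faces to be reached. *)
Lemma min_principle_strict (z : pt -> rat) (fs : pt) :
  (forall f, f \notin F -> z f = 0) -> fs \notin F ->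
  (forall f, f \in F -> 4 * z f - nbr_sum z f = (lam_adj f fs)%:R) ->
  connected_in lam_adj (fun c => c \in fs :: F) -> forall f, f \in F -> 0 < z f.
Proof.
move=> zF fsF Hz cF f fF.
have z0 : forall g, 0 <= z g.
  apply: min_principle => // g gF; have := Hz _ gF.
  by case: lam_adj => /=; lra.
rewrite lt_def z0 andbT; apply/eqP => zf.
suff [] : fs \in F /\ z fs = 0 by rewrite (negPf fsF).
apply: (conn_ind (S := fun c => c \in fs :: F) (Q := fun c => c \in F /\ z c = 0)
         cF _ (x := f)); last 3 first.
- by rewrite inE fF orbT.
- by rewrite inE eqxx.
- by [].
move=> a b aS bS ab [aF za].
have := Hz _ aF; rewrite za /nbr_sum.
have h1 := z0 (a.1 + 2, a.2); have h2 := z0 (a.1 - 2, a.2).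
have h3 := z0 (a.1, a.2 + 2); have h4 := z0 (a.1, a.2 - 2).
move: bS; rewrite inE => /orP[/eqP bfs|bF].
  by rewrite -bfs ab /=; lra.
case: (lam_adj a fs) => /=; first lra.
move=> H; split=> //; move: ab; rewrite lam_adjE => /or4P[]/eqP->; lra.
Qed.

Lemma Amx_mul (u : 'cV[rat]_(size F)) (z : pt -> rat) (i : 'I_(size F)) :
  (forall f, f \notin F -> z f = 0) -> (forall j : 'I_(size F), z (fc F j) = u j 0) ->
  (Amx F *m u) i 0 = 4 * z (fc F i) - nbr_sum z (fc F i).
Proof.
move=> zF zu; rewrite !mxE.
transitivity (\sum_(j < size F) ((fc F j == fc F i)%:R * (4 * z (fc F j))
   - (lam_adj (fc F i) (fc F j))%:R * z (fc F j))).
  apply: eq_bigr => j _; rewrite !mxE zu fc_inj // [j == i]eq_sym.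
  case: eqP => [->|_]; first by rewrite lam_adj_irr mul1r mul0r subr0.
  by case: lam_adj; rewrite !mul0r ?mulN1r ?mul1r sub0r ?oppr0.
rewrite (sum_fc F (fun f => (f == fc F i)%:R * (4 * z f) - (lam_adj (fc F i) f)%:R * z f)).
rewrite sumrB (sum_delta (z := fun f => 4 * z f)) ?fc_mem //; congr (_ - _).
under eq_bigr do rewrite lam_adj_natE !mulrDl.
by rewrite !big_split /= !sum_delta //; exact: zF.
Qed.

Lemma Amx_sym : (Amx F)^T = Amx F.
Proof. by apply/matrixP => i j; rewrite !mxE eq_sym lam_adj_sym. Qed.

(** A kernel vector is harmonic with zero boundary values, and the minimum principle applies to it
    and to its negative. *)
Lemma Amx_unit : Amx F \in unitmx.
Proof.
rewrite unitmxE unitfE; apply/det0P => -[u u0 uA].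
have Au : Amx F *m u^T = 0 by rewrite -[Amx F]Amx_sym -trmx_mul uA trmx0.
have [z [zF zu]] := vec_fun (fun j => u 0 j) uF.
have zuT (j : 'I_(size F)) : z (fc F j) = u^T j 0 by rewrite zu mxE.
have harm f : f \in F -> 4 * z f - nbr_sum z f = 0.
  move=> fF; have lf : (index f F < size F)%N by rewrite index_mem.
  by have := Amx_mul (Ordinal lf) zF zuT; rewrite Au mxE /= fc_index.
case/eqP: u0; apply/rowP => j; rewrite mxE -zu; apply/eqP; rewrite eq_le.
apply/andP; split; last by apply: min_principle => // f /harm; lra.
rewrite -oppr_ge0; apply: (min_principle (z := fun f => - z f)) => [f /zF->|f /harm].
  by rewrite oppr0.
by rewrite /nbr_sum; lra.
Qed.

Lemma pvec_gt0 fs (i : 'I_(size F)) : fs \notin F ->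
  connected_in lam_adj (fun c => c \in fs :: F) -> 0 < pvec F fs i 0.
Proof.
move=> fsF cF; set p := pvec F fs.
have Ap : Amx F *m p = bvec F fs by rewrite /p /pvec mulKVmx // Amx_unit.
have [z [zF zu]] := vec_fun (fun j => p j 0) uF.
rewrite -zu; apply: (min_principle_strict zF fsF _ cF); last exact: fc_mem.
move=> f fF; have lf : (index f F < size F)%N by rewrite index_mem.
have := Amx_mul (Ordinal lf) zF zu; rewrite Ap mxE /= fc_index // => <-.
by case: lam_adj.
Qed.

(** Cramer's rule replaces a column and here a row is replaced; the symmetry of [Amx F] reconciles
    the two. *)
Lemma det_Amx_row fs (Q : 'M[rat]_(size F)) i0 :
  (forall i j, i != i0 -> Q i j = Amx F i j) -> (forall j, Q i0 j = - bvec F fs j 0) ->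
  \det Q = - (\det (Amx F) * pvec F fs i0 0).
Proof.
move=> Qi Q0; have dA : \det (Amx F) != 0 by rewrite -unitfE -unitmxE Amx_unit.
rewrite (expand_det_row _ i0).
have -> : pvec F fs i0 0 = (\det (Amx F))^-1 * \sum_j \adj (Amx F) i0 j * bvec F fs j 0.
  rewrite /pvec /invmx Amx_unit -scalemxAl !mxE; congr (_ * _).
rewrite mulrA divff // mul1r -sumrN; apply: eq_bigr => j _.
rewrite Q0 mulNr mulrC !mxE; congr (- (_ * _)).
rewrite -[RHS]cofactor_tr Amx_sym /cofactor; congr (_ * \det _).
apply/matrixP => a b; have ai0 : lift i0 a != i0 by rewrite eq_sym neq_lift.
by rewrite !mxE Qi // !mxE.
Qed.

End Potential.

(** * Counting matchings by a determinant *)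

Lemma lift_fun (T : Type) (t0 : T) (s : seq pt) n (u : 'I_n -> T) : uniq s -> size s = n ->
  exists z : pt -> T, forall j : 'I_n, z (fc s j) = u j.
Proof.
move=> us sE; subst n.
exists (fun e => if insub (index e s) is Some j then u j else t0) => j.
rewrite /fc index_uniq //; case: insubP => [k _ kj|]; last by rewrite ltn_ord.
by congr u; apply: val_inj.
Qed.

(** If [x] is matched to [e], this has the entry [1] at [x] and [-1] at the other end of [e]: the
    pattern of a row of [graph_mx]. *)
Lemma K_sq_W0 x y e : inW0 x -> inW0 y -> black e -> K x e != 0 ->
  K y e * K x e = (y == x)%:R - ((y != x) && (K y e != 0))%:R.
Proof.
move=> x0 y0 be; rewrite !K_W0_neq0 // !K_W0E //.
have [->|yx] := eqVneq y x; last first.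
  case/orP => /eqP xE; move: yx; rewrite xE => /negPf yx;
    rewrite eqxx yx ?(negPf (epm e)) ?[em e == ep e]eq_sym ?(negPf (epm e)) /=.
    by rewrite subr0 mulr1.
  by rewrite orbF sub0r mulrN1 subr0 sub0r.
by case/orP => /eqP->; rewrite eqxx ?(negPf (epm e)) ?[em e == ep e]eq_sym ?(negPf (epm e)).
Qed.

Lemma K_sq_W1 x y e : inW1 x -> inW1 y -> black e -> K x e != 0 ->
  K y e * K x e = (y == x)%:R - ((y != x) && (K y e != 0))%:R.
Proof.
move=> x0 y0 be; rewrite !K_W1_neq0 // !K_W1E //.
have [->|yx] := eqVneq y x; last first.
  case/orP => /eqP xE; move: yx; rewrite xE => /negPf yx;
    rewrite eqxx yx ?(negPf (fpm e)) ?[fm e == fp e]eq_sym ?(negPf (fpm e)) /=.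
    by rewrite subr0 mulr1.
  by rewrite orbF sub0r mulrN1 subr0 sub0r.
by case/orP => /eqP->; rewrite eqxx ?(negPf (fpm e)) ?[fm e == fp e]eq_sym ?(negPf (fpm e)).
Qed.

(** An edge has only one other end, so the graph read off from a matching is functional. *)
Lemma K_other_W0 x y y' e : inW0 x -> inW0 y -> inW0 y' -> black e ->
  K x e != 0 -> (y != x) && (K y e != 0) -> (y' != x) && (K y' e != 0) -> y = y'.
Proof.
move=> x0 y0 y0' be; rewrite !K_W0_neq0 //.
by move=> /orP[] /eqP-> /andP[] yx /orP[]/eqP yE /andP[] yx' /orP[]/eqP yE';
  move: yx yx'; rewrite ?yE ?yE' ?eqxx.
Qed.

Lemma K_other_W1 x y y' e : inW1 x -> inW1 y -> inW1 y' -> black e ->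
  K x e != 0 -> (y != x) && (K y e != 0) -> (y' != x) && (K y' e != 0) -> y = y'.
Proof.
move=> x0 y0 y0' be; rewrite !K_W1_neq0 //.
by move=> /orP[] /eqP-> /andP[] yx /orP[]/eqP yE /andP[] yx' /orP[]/eqP yE';
  move: yx yx'; rewrite ?yE ?yE' ?eqxx.
Qed.

Lemma K_sq a e : inW0 a || inW1 a -> black e -> K a e * K a e = (K a e != 0)%:R.
Proof.
move=> a01 be; have [->|Ka] := eqVneq (K a e) 0; first by rewrite mulr0.
by case/orP: a01 => a0; [rewrite K_sq_W0 | rewrite K_sq_W1] => //; rewrite eqxx subr0.
Qed.

Section Signed.
Variables (F : seq pt) (fs v w : pt).
Hypotheses (uF : uniq F) (F1 : all inW1 F) (scF : sc_face_union F).
Hypotheses (fs1 : inW1 fs) (fsF : fs \notin F).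
Hypothesis cfs : connected_in lam_adj (fun c => c \in fs :: F).
Hypotheses (vF : v \in fs :: F) (wV : w \in VH F) (vw : w \in corners v).

Let eF : exact_faces F. Proof. by case: scF => _ _ /(sc_exact F1). Qed.
Let cF : skel_conn F. Proof. by case: scF => _ /(sc_skel F1). Qed.

Definition edges := undup (Mids F).
Definition prim_rows := rem w (undup (VH F)).
(** [fs] takes the position of [v], so that the rows of [C'] and [C] correspond index by index; for
    [v = fs] the list is [F] itself. *)
Definition dual_rows := [seq if f == v then fs else f | f <- F].
Definition rows := prim_rows ++ dual_rows.
Local Notation E := edges.
Local Notation V' := prim_rows.
Local Notation F' := dual_rows.
Local Notation nV := (size V').
Local Notation nF := (size F).
Local Notation N := (nV + nF)%N.

Lemma size_dual_rows : size F' = nF. Proof. by rewrite size_map. Qed.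

(** By the Euler formula the Kasteleyn matrix is square. *)
Lemma size_edges : size E = N.
Proof.
have := euler uF F1 wV erefl cF eF; rewrite (size_V' wV) addSn => -[->].
by [].
Qed.

Lemma size_rows : size rows = N. Proof. by rewrite size_cat size_dual_rows. Qed.

Lemma mem_dual_rows f : (f \in F') = (f != v) && (f \in fs :: F).
Proof.
apply/mapP/andP => [[g gF ->]|[fv]].
  have [gv|gv] := eqVneq g v; last by rewrite gv inE gF orbT.
  rewrite inE eqxx; split=> //; apply: contraNneq fsF => ->.
  by rewrite -gv.
rewrite inE => /orP[/eqP fE|fF]; last by exists f; rewrite // (negPf fv).
exists v; rewrite ?eqxx //; move: vF fv; rewrite inE fE => /orP[/eqP->|//].
by rewrite eqxx.
Qed.

Lemma mem_rows a : (a \in rows) =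
  ((a \in VH F) && (a != w)) || ((a \in fs :: F) && (a != v)).
Proof. by rewrite mem_cat (mem_V' F w) mem_dual_rows andbC [(a != v) && _]andbC. Qed.

Lemma dual_rows_W1 f : f \in F' -> inW1 f.
Proof. by rewrite mem_dual_rows inE => /andP[_ /orP[/eqP->|/(allP F1)]]. Qed.

Lemma prim_rows_W0 x : x \in V' -> inW0 x.
Proof. by rewrite (mem_V' F w) => /andP[_ /(VH_W0 F1)]. Qed.

Lemma uniq_prim : uniq V'. Proof. by rewrite rem_uniq // undup_uniq. Qed.

Lemma uniq_rows : uniq rows.
Proof.
rewrite cat_uniq uniq_prim /=; apply/andP; split.
  by apply/hasPn => f /dual_rows_W1 f1; apply/negP => /prim_rows_W0 /W01 /(_ f1).
rewrite map_inj_in_uniq // => f g fF gF.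
case: eqP => [->|_]; case: eqP => [->|_] // h.
  by move: gF fsF; rewrite -h => ->.
by move: fF fsF; rewrite h => ->.
Qed.

Lemma fc_lshift (i : 'I_nV) : fc rows (lshift nF i) = fc V' i.
Proof. by rewrite /fc nth_cat /= ltn_ord. Qed.

Lemma fc_rshift (i : 'I_nF) : fc rows (rshift nV i) = fc F' i.
Proof. by rewrite /fc nth_cat /= ltnNge leq_addr /= addKn. Qed.

Lemma fc_dual (i : 'I_nF) : fc F' i = if fc F i == v then fs else fc F i.
Proof. by rewrite /fc (nth_map (0, 0)). Qed.

Lemma fc_dual_mem (i : 'I_nF) : fc F' i \in F'.
Proof. by rewrite /fc mem_nth // size_dual_rows. Qed.

Lemma fc_rows_mem (i : 'I_N) : fc rows i \in rows.
Proof. by rewrite /fc mem_nth // size_rows. Qed.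

Lemma fc_E_mem (i : 'I_N) : fc E i \in E.
Proof. by rewrite /fc mem_nth // size_edges. Qed.

Lemma fc_E_black (i : 'I_N) : black (fc E i).
Proof. exact: (E_black F1 (fc_E_mem i)). Qed.

Lemma fc_V'_W0 (i : 'I_nV) : inW0 (fc V' i).
Proof. exact/prim_rows_W0/fc_mem. Qed.

Lemma fc_F'_W1 (i : 'I_nF) : inW1 (fc F' i).
Proof. exact/dual_rows_W1/fc_dual_mem. Qed.

Lemma fc_F_W1 (i : 'I_nF) : inW1 (fc F i).
Proof. exact/(allP F1)/fc_mem. Qed.

Definition Kast := Kmx int N N rows E.
Let D := Kmx int nV N V' E.
Let C := Kmx int nF N F E.
Let C' := Kmx int nF N F' E.

Lemma KastE : Kast = col_mx D C'.
Proof.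
apply/matrixP => i j; rewrite -[i]splitK; case: (split i) => k /=;
  by rewrite ?col_mxEu ?col_mxEd !mxE ?fc_lshift ?fc_rshift.
Qed.

Lemma Kast01 i j : Kast i j * Kast i j = (Kast i j != 0)%:R.
Proof.
rewrite mxE intz K_sq ?fc_E_black //.
rewrite -[i]splitK; case: (split i) => k /=; rewrite ?fc_lshift ?fc_rshift.
  by rewrite fc_V'_W0.
by rewrite fc_F'_W1 orbT.
Qed.

(** The transpose is the matrix of the graph sending a vertex to the other end of its matched edge,
    undefined when that end is [w]; [no_cycle] makes this graph acyclic. *)
Lemma Kast_primal s : valid_perm Kast s -> \det (D *m (usubmx (term_mx Kast s))^T) = 1.
Proof.
move=> /forallP vs.
have vK (i : 'I_N) : K (fc rows i) (fc E (s i)) != 0 by have := vs i; rewrite mxE intz.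
have vKV (i : 'I_nV) : K (fc V' i) (fc E (s (lshift nF i))) != 0 by rewrite -fc_lshift.
pose phi (i j : 'I_nV) :=
  (fc V' j != fc V' i) && (K (fc V' j) (fc E (s (lshift nF i))) != 0).
have -> : D *m (usubmx (term_mx Kast s))^T = (graph_mx phi)^T.
  apply/matrixP => i j; rewrite !mxE (bigD1 (s (lshift nF j))) //= !mxE eqxx mulr1.
  rewrite big1 ?addr0 => [|k /negPf ks]; last by rewrite !mxE eq_sym ks !mulr0.
  rewrite fc_lshift !intz K_sq_W0 ?fc_V'_W0 ?fc_E_black //.
  by congr (_%:R - _); rewrite fc_inj ?uniq_prim // eq_sym.
rewrite det_tr det_graph => [|i j j' pij pij']; last first.
  apply/eqP; rewrite -(fc_inj _ _ uniq_prim); apply/eqP.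
  by apply: K_other_W0 pij pij'; rewrite ?fc_V'_W0 ?fc_E_black // vKV.
suff -> : acyclic phi by [].
apply/andP; split; first by apply/forallP => i; rewrite /phi eqxx.
apply/forallP => t; apply/implyP => /forallP tphi; apply/negPn/negP => t1.
(* The orbit of a moved point is the list [Y] to which [no_cycle] is applied. *)
have [i0 ti0] : exists i0, t i0 != i0.
  apply/existsP; apply: contraR t1; rewrite negb_exists => /forallP h.
  by apply/eqP/permP => i; rewrite perm1; apply/eqP/negPn.
have tP i : i \in porbit t i0 -> (t i != i) && phi i (t i).
  move=> io; have ti : t i != i.
    apply: contra ti0 => /eqP ti; move: io => /porbitP[k ik].
    by rewrite -(inj_eq (@perm_inj _ (t ^+ k)%g)) -!permM -expgS expgSr permM -ik ti.
  by have := tphi i; rewrite ti (negPf ti).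
have [m mE] := lift_fun (0, 0) (fun i : 'I_N => fc E (s i)) uniq_rows size_rows.
have [nx nxE] := lift_fun (0, 0) (fun i : 'I_nV => fc V' (t i)) uniq_prim erefl.
pose Y := [seq fc V' (i : 'I_nV) | i <- enum (porbit t i0)].
have rowi a : a \in rows -> exists i : 'I_N, a = fc rows i.
  move=> ar; have la : (index a rows < N)%N by rewrite -size_rows index_mem.
  by exists (Ordinal la); rewrite /= fc_index.
have mV' (i : 'I_nV) : m (fc V' i) = fc E (s (lshift nF i)) by rewrite -fc_lshift mE.
have mEK a : a \in rows -> m a \in Mids F /\ K a (m a) != 0.
  by move=> /rowi[i ->]; rewrite mE vK -mem_undup fc_E_mem.
have YP x : x \in Y -> exists2 i : 'I_nV, i \in porbit t i0 & x = fc V' i.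
  by move=> /mapP[i]; rewrite mem_enum => ip ->; exists i.
have Yi (i : 'I_nV) : i \in porbit t i0 -> fc V' i \in Y.
  by move=> ip; apply/mapP; exists i; rewrite ?mem_enum.
have to i : i \in porbit t i0 -> t i \in porbit t i0.
  by move=> /porbitP[k ->]; rewrite -permM -expgSr mem_porbit.
apply: (@no_cycle F fs v w m nx Y (fc V' i0)) => //.
- by move=> x xV xw; apply: mEK; rewrite mem_rows xV xw.
- by move=> f fF fv; apply: mEK; rewrite mem_rows fF fv orbT.
- move=> a b; rewrite -!mem_rows => /rowi[i ->] /rowi[j ->]; rewrite !mE => /eqP.
  rewrite /fc nth_uniq ?size_edges ?undup_uniq // => /eqP/val_inj/perm_inj -> //.
- move=> e; rewrite -mem_undup => eE.
  have le : (index e E < N)%N by rewrite -size_edges index_mem.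
  exists (fc rows ((s^-1)%g (Ordinal le))); first by rewrite -mem_rows fc_rows_mem.
  by rewrite mE permKV /= fc_index.
- by rewrite map_inj_uniq ?enum_uniq // => i j /eqP; rewrite fc_inj ?uniq_prim // => /eqP.
- exact/Yi/porbit_id.
- by move=> x /YP[i _ ->]; have := fc_mem i; rewrite (mem_V' F w) andbC.
- by move=> x /YP[i ip ->]; rewrite nxE Yi ?to.
- by move=> x /YP[i ip ->]; rewrite nxE fc_inj ?uniq_prim //; case/andP: (tP _ ip).
- by move=> x /YP[i ip ->]; rewrite nxE mV'; case/andP: (tP _ ip) => _ /andP[].
- move=> x y /YP[i ip ->] /YP[j jp ->]; rewrite !nxE => /eqP.
  by rewrite fc_inj ?uniq_prim // => /eqP/perm_inj->.
- move=> P P0 Pn x /YP[i /porbitP[k ->] ->] {x i}.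
  elim: k => [|k IH]; first by rewrite expg0 perm1.
  by rewrite expgSr permM -nxE; apply: Pn => //; rewrite Yi // mem_porbit.
Qed.

Let eta : int := if v == fs then 1 else -1.

(** For [v = fs] the product is a graph matrix, of determinant [0] or [1]. Otherwise the row of [v]
    belongs to [fs] and has no diagonal [1], which is the case of [det_graph_root]. *)
Lemma Kast_dual s : valid_perm Kast s ->
  0 <= eta * \det (dsubmx (term_mx Kast s) *m C^T).
Proof.
move=> /forallP vs.
have vK (i : 'I_N) : K (fc rows i) (fc E (s i)) != 0 by have := vs i; rewrite mxE intz.
have vKF (i : 'I_nF) : K (fc F' i) (fc E (s (rshift nV i))) != 0 by rewrite -fc_rshift.
pose phi (i j : 'I_nF) :=
  (fc F j != fc F' i) && (K (fc F j) (fc E (s (rshift nV i))) != 0).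
have fphi : functional phi.
  move=> i j j' pij pij'; apply/eqP; rewrite -(fc_inj _ _ uF); apply/eqP.
  by apply: K_other_W1 pij pij'; rewrite ?fc_F'_W1 ?fc_F_W1 ?fc_E_black.
have -> : dsubmx (term_mx Kast s) *m C^T =
   \matrix_(i, j) ((fc F j == fc F' i)%:R - (phi i j)%:R).
  apply/matrixP => i j; rewrite !mxE (bigD1 (s (rshift nV i))) //= !mxE eqxx mulr1.
  rewrite big1 ?addr0 => [|k /negPf ks]; last by rewrite !mxE eq_sym ks mulr0 mul0r.
  by rewrite fc_rshift !intz mulrC K_sq_W1 ?fc_F'_W1 ?fc_F_W1 ?fc_E_black.
rewrite /eta; have [vfs|vfs] := eqVneq v fs.
  rewrite mul1r (_ : \matrix_(i, j) _ = graph_mx phi) ?det_graph ?ler0n //.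
  apply/matrixP => i j; rewrite !mxE fc_dual vfs.
  have -> : (fc F i == fs) = false by apply/eqP => fi; move: fsF; rewrite -fi fc_mem.
  by rewrite fc_inj // [j == i]eq_sym.
rewrite mulN1r oppr_ge0.
have vF' : v \in F by move: vF; rewrite inE (negPf vfs).
have lv : (index v F < nF)%N by rewrite index_mem.
have := det_graph_root (Ordinal lv) fphi; congr (\det _ <= 0).
apply/matrixP => i j; rewrite !mxE fc_dual; congr (_%:R - _).
have -> : (i != Ordinal lv) = (fc F i != v).
  by rewrite -(fc_inj i _ uF) /= fc_index.
have [_|_] := eqVneq (fc F i) v; rewrite ?andbT ?andbF; last by rewrite fc_inj // eq_sym.
by have -> : (fc F j == fs) = false by apply/negbTE/eqP => fi; move: fsF; rewrite -fi fc_mem.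
Qed.

Let Q := C' *m C^T.

Lemma Q_entry i j : Q i j = if fc F' i == fc F j then 4 else
  if lam_adj (fc F' i) (fc F j) then -1 else 0.
Proof.
rewrite mxE; under eq_bigr do rewrite !mxE mulrC.
rewrite (sum_E size_edges (fun e => (K (fc F j) e)%:~R * (K (fc F' i) e)%:~R)).
rewrite (sumK_face F1) ?fc_mem // -curlK_W1 ?fc_F'_W1 ?fc_F_W1 //.
by rewrite /curl !intz.
Qed.

Let Q_rat i j : map_mx intr Q i j = if fc F' i == fc F j then 4 else
  if lam_adj (fc F' i) (fc F j) then -1 else 0 :> rat.
Proof. by rewrite mxE Q_entry; case: eqP => // _; case: ifP. Qed.

(** For [v = fs] the matrix [Q] is [Amx F]; otherwise its row at [v] is minus the vector
    [bvec F fs], and Cramer's rule applies. *)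
Lemma det_Q : `|(\det Q)%:~R| = `|\det (Amx F)| * pval F fs v :> rat.
Proof.
rewrite -det_map_mx /pval; have [vfs|vfs] := eqVneq v fs.
  rewrite mulr1; congr (`|\det _|); apply/matrixP => i j.
  rewrite Q_rat !mxE fc_dual vfs.
  have -> : (fc F i == fs) = false by apply/eqP => fi; move: fsF; rewrite -fi fc_mem.
  by rewrite fc_inj.
have vF' : v \in F by move: vF; rewrite inE (negPf vfs).
have lv : (index v F < nF)%N by rewrite index_mem.
case: pickP => [i /eqP iv|/(_ (Ordinal lv))]; last by rewrite /= fc_index ?eqxx.
rewrite [X in `|X| = _](@det_Amx_row _ uF fs _ i).
- by rewrite normrN normrM; congr (_ * _); rewrite gtr0_norm // pvec_gt0.
- move=> k j ki; rewrite Q_rat !mxE fc_dual.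
  have -> : (fc F k == v) = false by rewrite -iv fc_inj // (negPf ki).
  by rewrite fc_inj.
- move=> j; rewrite Q_rat !mxE fc_dual iv eqxx.
  have -> : (fs == fc F j) = false by apply/eqP => fi; move: fsF; rewrite fi fc_mem.
  by rewrite lam_adj_sym; case: ifP; rewrite ?oppr0.
Qed.

Lemma pval_gt0 : 0 < pval F fs v.
Proof.
rewrite /pval; have [//|vfs] := eqVneq v fs.
have vF' : v \in F by move: vF; rewrite inE (negPf vfs).
have lv : (index v F < nF)%N by rewrite index_mem.
case: pickP => [i _|/(_ (Ordinal lv))]; last by rewrite /= fc_index ?eqxx.
exact: pvec_gt0.
Qed.

Lemma card_valid_Kast :
  (#|[set s | valid_perm Kast s]|)%:R = `|\det (Amx F)| * pval F fs v :> rat.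
Proof.
have DC : D *m C^T = 0 by apply: DC_orth => //; exact: size_edges.
have Q0 : \det Q != 0.
  rewrite -(intr_eq0 rat) -normr_eq0 det_Q mulf_neq0 ?gt_eqF ?pval_gt0 //.
  by rewrite normr_gt0 -unitfE -unitmxE Amx_unit.
have eta0 : eta != 0 by rewrite /eta; case: ifP.
rewrite -det_Q -intr_norm.
have [X DX] : exists X, D *m X = 1%:M by apply: D_right_inverse => //; exact: size_edges.
have [Z CZ] : exists Z, C *m Z = 1%:M by apply: C_right_inverse => //; exact: size_edges.
rewrite -(det_col_mx_orth _ DX CZ DC) -KastE.
by rewrite -(card_valid KastE Kast01 DC eta0 Kast_primal Kast_dual Q0).
Qed.

End Signed.

(** * The corners of the outer vertex *)

Lemma W0_white a : inW0 a -> ~~ black a.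
Proof. by case: a => a b; ptl. Qed.

Lemma W1_white a : inW1 a -> ~~ black a.
Proof. by case: a => a b; ptl. Qed.

Lemma pt_cases a : [\/ inW0 a, inW1 a | black a].
Proof.
have [h0|h0] := boolP (inW0 a); first by constructor 1.
have [h1|h1] := boolP (inW1 a); first by constructor 2.
by constructor 3; case: a h0 h1 => a b; ptl.
Qed.

Lemma mem_unit_steps a b : dvec a b \in unit_steps ->
  [\/ a = (b.1 + 1, b.2), a = (b.1 - 1, b.2), a = (b.1, b.2 + 1) | a = (b.1, b.2 - 1)].
Proof.
case: a b => [a1 a2] [b1 b2]; rewrite /dvec !inE !xpair_eqE /=.
case/or4P => /andP[/eqP h1 /eqP h2];
  [constructor 1|constructor 2|constructor 3|constructor 4]; apply: pt_eqP; lia.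
Qed.

Lemma mem_diag_steps a b : (dvec a b \in diag_steps) = (b \in corners a).
Proof.
case: a b => [a1 a2] [b1 b2]; rewrite /dvec /corners /diag_steps /shift /= !inE !xpair_eqE /=.
have E (x y c : int) : (x - y == c) = (y == x - c) by lia.
rewrite !E !opprK orbCA; congr [|| _, _ | _]; exact: orbC.
Qed.

Lemma gamma_adj_blackE a b : black b -> gamma_adj a b = (dvec a b \in unit_steps).
Proof. by rewrite /gamma_adj /white /black => ->; rewrite andbF orbF. Qed.

Lemma unit_step_in a b : [|| a == (b.1 + 1, b.2), a == (b.1 - 1, b.2),
  a == (b.1, b.2 + 1) | a == (b.1, b.2 - 1)] -> dvec a b \in unit_steps.
Proof.
by case/or4P => /eqP->; case: b => x y; rewrite /dvec !inE !xpair_eqE /=; lia.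
Qed.

Lemma gamma_adj_W0_black a b : inW0 a -> black b -> gamma_adj a b = (K a b != 0).
Proof.
move=> a0 bb; rewrite K_W0_neq0 // gamma_adj_blackE //; apply/idP/idP.
  by case/mem_unit_steps => aE; move: a0; rewrite aE; case: b bb {aE} => b1 b2; pts => ? ?;
    ptcase; lia.
move=> h; apply: unit_step_in; case/orP: h => /eqP->; rewrite /ep /em; case: ifP => _;
  by rewrite eqxx ?orbT.
Qed.

Lemma gamma_adj_W1_black a b : inW1 a -> black b -> gamma_adj a b = (K a b != 0).
Proof.
move=> a0 bb; rewrite K_W1_neq0 // gamma_adj_blackE //; apply/idP/idP.
  by case/mem_unit_steps => aE; move: a0; rewrite aE; case: b bb {aE} => b1 b2; pts => ? ?;
    ptcase; lia.
move=> h; apply: unit_step_in; case/orP: h => /eqP->; rewrite /fp /fm; case: ifP => _;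
  by rewrite eqxx ?orbT.
Qed.

Lemma gamma_adj_sym : symmetric gamma_adj.
Proof.
case=> a1 a2 [b1 b2]; rewrite /gamma_adj /dvec !inE !xpair_eqE /=; congr (_ || _); first by lia.
by rewrite andbCA; congr [&& _, _ & _]; lia.
Qed.

Lemma gamma_adj_irr a : gamma_adj a a = false.
Proof. by case: a => a1 a2; rewrite /gamma_adj /dvec !inE !xpair_eqE /= !subrr /= !andbF. Qed.

Lemma unit_step_black a b : dvec a b \in unit_steps -> black a = ~~ black b.
Proof. by case/mem_unit_steps => ->; case: b => b1 b2; ptl. Qed.

Lemma gamma_adj_black a b : black a -> gamma_adj a b -> ~~ black b.
Proof.
move=> ba; rewrite /gamma_adj => /orP[/unit_step_black <-//|/and3P[]].
by rewrite /white -/(black a) ba.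
Qed.

Lemma gamma_adj_white a b : ~~ black a -> ~~ black b -> gamma_adj a b = (b \in corners a).
Proof.
move=> wa wb; rewrite /gamma_adj /white -/(black a) -/(black b) wa wb -mem_diag_steps /=.
by case: (boolP (_ \in unit_steps)) => // /unit_step_black; rewrite (negPf wa) wb.
Qed.

Lemma corners_W0 a b : b \in corners a -> inW0 a = inW1 b.
Proof. by rewrite !inE => /or4P[]/eqP->; case: a => a1 a2; ptl. Qed.

Lemma corners_W1 a b : b \in corners a -> inW1 a = inW0 b.
Proof. by rewrite !inE => /or4P[]/eqP->; case: a => a1 a2; ptl. Qed.

Lemma sum_eq_mem (G : seq pt) : uniq G -> forall p, \sum_(f <- G) ((f == p)%:R : rat) = (p \in G)%:R.
Proof.
move=> uG p; under eq_bigr do rewrite -[_%:R]mulr1.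
have [pG|pG] := boolP (p \in G); first by rewrite (sum_delta (z := fun=> 1)) // pG.
by rewrite big_seq big1 // => f fG; rewrite (negPf (memPn pG _ fG)) mul0r.
Qed.

Lemma size_undup_cat (T : eqType) (s1 s2 : seq T) : uniq s1 ->
  size (undup (s1 ++ s2)) = (count (fun x => x \notin s2) s1 + size (undup s2))%N.
Proof.
elim: s1 => //= a s1 IH /andP[as1 us1]; rewrite mem_cat (negPf as1) /=.
by case: (a \in s2); rewrite /= IH.
Qed.

Lemma mids_faces f : inW1 f ->
  [/\ fp (f.1, f.2 + 1) = f /\ fm (f.1, f.2 + 1) = (f.1, f.2 + 2),
      fp (f.1 - 1, f.2) = f /\ fm (f.1 - 1, f.2) = (f.1 - 2, f.2) &
      fp (f.1, f.2 - 1) = (f.1, f.2 - 2) /\ fm (f.1, f.2 - 1) = f].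
Proof.
by case: f => a b; pts => f1; split; ptcase; split; try apply: pt_eqP; lia.
Qed.

Lemma uniq_corners f : uniq (corners f).
Proof.
by rewrite /corners map_inj_uniq // => -[a b] [c d] []; rewrite /shift /= => /addrI-> /addrI->.
Qed.

Section Outer.
Variables (F : seq pt) (fs : pt).
Hypotheses (uF : uniq F) (F1 : all inW1 F) (fs1 : inW1 fs) (fsF : fs \notin F).
Hypothesis nG : connected_in gamma_adj (fun v => v \notin VG F fs).
Let G := fs :: F.
Let G1 : all inW1 G. Proof. by rewrite /= fs1. Qed.

Lemma mem_VG a : (a \in VG F fs) = [|| a \in VH F, a \in G | a \in Mids F].
Proof. by rewrite mem_undup !mem_cat. Qed.

Lemma VG_W1 a : inW1 a -> (a \in VG F fs) = (a \in G).
Proof.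
move=> a1; rewrite mem_VG; case: (boolP (a \in VH F)) => [/(VH_W0 F1)/W01/(_ a1)//|_].
by case: (boolP (a \in Mids F)) => [/(Mids_black F1)|]; rewrite ?(negPf (W1_white a1)) // orbF.
Qed.

Lemma VG_W0 a : inW0 a -> (a \in VG F fs) = (a \in VH F).
Proof.
move=> a0; rewrite mem_VG; case: (boolP (a \in G)) => [/(allP G1) /(W01 a0)//|_].
by case: (boolP (a \in Mids F)) => [/(Mids_black F1)|]; rewrite ?(negPf (W0_white a0)) //= ?orbF.
Qed.

Lemma VG_black a : black a -> (a \in VG F fs) = (a \in Mids F).
Proof.
move=> ba; rewrite mem_VG; case: (boolP (a \in VH F)) => [/(VH_W0 F1)/W0_white|_].
  by rewrite ba.
by case: (boolP (a \in G)) => [/(allP G1)/W1_white|]; rewrite ?ba.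
Qed.

(** By normality a path of the graph outside [VG F fs] leads from [c] to a far face. The value of
    [h] is carried along it by the faces close to its points, since the path itself also visits
    vertices and edges. *)
Lemma exact_outer : exact_faces G.
Proof.
move=> h [B hB] hE c c1 cG; have [B' GB'] := bounded_right G.
pose far : pt := (2 * (`|B| + `|B'|) + 1, 1).
have hfar : h far = 0 by apply: hB; rewrite /far /=; lia.
have farG : far \notin G by apply/negP => /GB'; rewrite /far /=; lia.
have far1 : inW1 far by rewrite /far; ptl.
(* The faces close to a point: the face itself, the four faces around a vertex, or the two sides of
   an edge. *)
pose near (a d : pt) := if inW1 a then d == a else if inW0 a then d \in corners a
  else (d == fp a) || (d == fm a).
have near1 a d : inW1 a -> near a d = (d == a) by rewrite /near => ->.
have near0 a d : inW0 a -> near a d = (d \in corners a).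
  by move=> a0; rewrite /near a0; case: ifP => // /(W01 a0).
have nearb a d : black a -> near a d = (d == fp a) || (d == fm a).
  move=> ba; rewrite /near; case: ifP => [/W1_white|]; first by rewrite ba.
  by case: ifP => [/W0_white|]; first by rewrite ba.
have near_W1 a d : near a d -> inW1 d.
  case: (pt_cases a) => ha.
  - by rewrite near0 // => dc; rewrite -(corners_W0 dc).
  - by rewrite near1 // => /eqP->.
  - by rewrite nearb // => /orP[]/eqP->; rewrite ?fp_W1 ?fm_W1.
have notG d : d \notin F -> d != fs -> d \notin G by rewrite inE negb_or => -> ->.
(* Around a vertex outside [VH F] at most one of the four faces, namely [fs], is in [G]; two others
   are joined by turning around the vertex on the side avoiding it. *)
have same a d d' : a \notin VG F fs -> near a d -> near a d' -> d \notin G -> d' \notin G ->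
    h d = h d'.
  case: (pt_cases a) => ha; [rewrite VG_W0 // | rewrite VG_W1 // | rewrite VG_black //].
  - have [b1 b2 b3 b4] := star_black ha; have [e1 e2 e3 e4] := edge_faces ha.
    have h1 := hE _ b1; have h2 := hE _ b2; have h3 := hE _ b3; have h4 := hE _ b4.
    move: h1 h2 h3 h4; rewrite e1.1 e1.2 e2.1 e2.2 e3.1 e3.2 e4.1 e4.2.
    rewrite !near0 // mem_VH => h1 h2 h3 h4 aV.
    set p1 := (a.1 + 1, a.2 - 1) in h1 h4; set p2 := (a.1 + 1, a.2 + 1) in h1 h3.
    set p3 := (a.1 - 1, a.2 - 1) in h2 h4; set p4 := (a.1 - 1, a.2 + 1) in h2 h3.
    have nF x : x \in corners a -> x \notin F by move=> xc; exact: (hasPn aV).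
    have q14 : (p1 \notin G) || (p4 \notin G).
      rewrite -negb_and; apply/negP => /andP[]; rewrite !inE.
      rewrite (negPf (nF p1 _)) ?(negPf (nF p4 _)) ?orbF ?inE /shift ?eqxx ?orbT //.
      by move=> /eqP <- /eqP[]; clear; lia.
    have q23 : (p2 \notin G) || (p3 \notin G).
      rewrite -negb_and; apply/negP => /andP[]; rewrite !inE.
      rewrite (negPf (nF p2 _)) ?(negPf (nF p3 _)) ?orbF ?inE /shift ?eqxx ?orbT //.
      by move=> /eqP <- /eqP[]; clear; lia.
    have d23 : p2 \notin G -> p3 \notin G -> h p2 = h p3.
      by move=> g2 g3; case/orP: q14 => g; [rewrite -h1 // h4 | rewrite h3 // -h2].
    have d14 : p1 \notin G -> p4 \notin G -> h p1 = h p4.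
      by move=> g1 g4; case/orP: q23 => g; [rewrite h1 // h3 | rewrite h4 // h2].
    rewrite !inE /shift /= -/p1 -/p2 -/p3 -/p4.
    by move=> /or4P[]/eqP-> /or4P[]/eqP-> g g' //; auto; symmetry; auto.
  - by rewrite !near1 // => _ /eqP-> /eqP->.
  - rewrite !nearb // => aM /orP[]/eqP-> /orP[]/eqP-> g g' //; first exact: hE.
    by symmetry; apply: hE.
(* Neither side of an edge outside [Mids F] is in [F], and at most one side is [fs]. *)
have shareB a b : black b -> a \notin VG F fs -> b \notin VG F fs -> gamma_adj a b ->
    exists2 d, d \notin G & near a d /\ near b d.
  move=> bb aG bG ab; move: bG; rewrite VG_black // mem_Mids // bb negb_or => /andP[pF mF].
  have [a0|a1|ba] := pt_cases a; last first.
  - by have := gamma_adj_black ba ab; rewrite bb.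
  - move: ab; rewrite gamma_adj_W1_black // K_W1_neq0 // => ab.
    by exists a; [rewrite -VG_W1 | rewrite near1 // nearb // eqxx].
  move: ab; rewrite gamma_adj_W0_black // K_W0_neq0 // => /(ends_corners bb)/andP[k1 k2].
  have [pfs|pfs] := eqVneq (fp b) fs.
    exists (fm b); last by rewrite near0 // nearb // k2 eqxx orbT.
    by apply: notG; rewrite // -pfs eq_sym fpm.
  by exists (fp b); [apply: notG | rewrite near0 // nearb // k1 eqxx].
have shareD a b : inW0 a -> inW1 b -> b \notin VG F fs -> gamma_adj a b ->
    exists2 d, d \notin G & near a d /\ near b d.
  move=> a0 b1 bG; rewrite (gamma_adj_white (W0_white a0) (W1_white b1)) => ba.
  by exists b; [rewrite -VG_W1 | rewrite near0 // near1 // eqxx].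
have share a b : a \notin VG F fs -> b \notin VG F fs -> gamma_adj a b ->
    exists2 d, d \notin G & near a d /\ near b d.
  move=> aG bG ab; have ba : gamma_adj b a by rewrite gamma_adj_sym.
  have swap : (exists2 d, d \notin G & near b d /\ near a d) ->
      exists2 d, d \notin G & near a d /\ near b d by case=> d dG []; exists d.
  have ww : ~~ black a -> ~~ black b -> inW0 a = inW1 b /\ inW1 a = inW0 b.
    move=> wa wb; move: ab; rewrite gamma_adj_white // => cb.
    by rewrite (corners_W0 cb) (corners_W1 cb).
  have [b0|b1|bb] := pt_cases b; last exact: shareB.
    have [a0|a1|aa] := pt_cases a; last exact/swap/shareB.
      have [a1 _] := ww (W0_white a0) (W0_white b0).
      by case: (W01 b0); rewrite -a1.
    exact/swap/shareD.
  have [a0|a1|aa] := pt_cases a; [exact: shareD| |exact/swap/shareB].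
  have [_ b0] := ww (W1_white a1) (W1_white b1).
  by case: (W01 (a := b)); rewrite -?b0.
rewrite -hfar; symmetry.
suff Qc : forall d, d \notin G -> near c d -> h far = h d by apply: Qc; rewrite ?near1.
apply: (@conn_ind gamma_adj _ (fun a => forall d, d \notin G -> near a d -> h far = h d)
         nG _ far c).
- move=> a b aG bG ab Qa d' dG' bd.
  have [d0 d0G [ad0 bd0]] := share a b aG bG ab.
  by rewrite (Qa d0) //; apply: (same b).
- by rewrite VG_W1.
- by rewrite VG_W1.
- by move=> d' _; rewrite near1 // => /eqP->.
Qed.

Hypothesis scF : sc_face_union F.
Hypothesis cfs : connected_in lam_adj (fun c => c \in fs :: F).

Lemma king_outer : connected_in king_adj (fun c => c \in G).
Proof.
move=> x y xG yG; have [p [pp pl pG]] := cfs xG yG; exists p; split=> //.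
apply: sub_path pp => a b; rewrite /lam_adj /king_adj /king_steps mem_cat => ->.
by [].
Qed.

Lemma count_mids_fs : (count (fun e => e \in Mids F) (mids fs) = dstar F fs)%N.
Proof.
apply/eqP; rewrite -(eqr_nat rat) /dstar -sum1_count -[X in _ == X%:R]sum1_count.
rewrite !natr_sum big_mkcond [X in _ == X]big_mkcond /= [X in _ == X](eq_bigr (fun f => (lam_adj fs f)%:R)); last first.
  by move=> f _; case: lam_adj.
under [X in _ == X]eq_bigr do rewrite lam_adj_natE.
rewrite !big_split /= !sum_eq_mem // /mids /= !big_cons big_nil !mem_Mids //.
have [b1 b2 b3 b4] := mids_black fs1.
rewrite /shift /= !addr0 b1 b2 b3 b4 /=.
have [_ -> ->] := right_faces fs1.
have [[-> ->] [-> ->] [-> ->]] := mids_faces fs1.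
rewrite (negPf fsF) !orbF /rt /= !addrA.
by do 4!case: (_ \in F); rewrite ?eqxx.
Qed.

(** If [fs] has [k] corners in [H], adding it to [F] brings [4 - k] vertices, [4 - dstar F fs] edges
    and one face. The Euler formula before and after gives [k]. *)
Lemma corners_count : (count (fun x => x \in VH F) (corners fs) = (dstar F fs).+1)%N.
Proof.
have F0 : F != [::] by case: scF.
have [f fF] : exists f, f \in F by case: (F) F0 => // a s _; exists a; rewrite inE eqxx.
have cor f' H : f' \in H -> (f'.1 + 1, f'.2 + 1) \in VH H.
  by move=> fH; apply/flatten_mapP; exists f'; rewrite // inE /shift eqxx.
have skF : skel_conn F by case: scF => _ /(sc_skel F1).
have exF : exact_faces F by case: scF => _ _ /(sc_exact F1).
have eF := euler uF F1 (cor _ _ fF) erefl skF exF.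
have uG : uniq G by rewrite /= fsF.
have eG := euler uG G1 (cor fs G (mem_head _ _)) erefl (sc_skel G1 king_outer) exact_outer.
have uc := uniq_corners fs.
have um : uniq (mids fs).
  by rewrite /mids map_inj_uniq // => -[a b] [c d] []; rewrite /shift /= => /addrI-> /addrI->.
have eV : size (undup (VH G)) = (count (fun x => x \notin VH F) (corners fs) +
    size (undup (VH F)))%N by exact: size_undup_cat.
have eM : size (undup (Mids G)) = (count (fun x => x \notin Mids F) (mids fs) +
    size (undup (Mids F)))%N by exact: size_undup_cat.
have h1 := count_predC (fun x => x \in VH F) (corners fs).
have h2 := count_predC (fun x => x \in Mids F) (mids fs).
move: eG h1 h2 eF; rewrite count_mids_fs eV eM /predC /=.
clear; lia.
Qed.

End Outer.

(** * Dimer coverings as involutions *)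

Section Mates.
Variable V : seq pt.
Local Notation T := (vtx V).
Implicit Types (m : {ffun T -> T}) (M : {set {set T}}).

(** Coverings are encoded as involutions along edges; they have no fixed point because [gamma_adj]
    is irreflexive. *)
Definition mating m :=
  [forall x, (m (m x) == x) && gamma_adj (val x) (val (m x))].

Definition dimer_of m : {set {set T}} := [set [set x; m x] | x : T].

Lemma matingP m : reflect (forall x, m (m x) = x /\ gamma_adj (val x) (val (m x))) (mating m).
Proof.
apply: (iffP forallP) => h x; first by have /andP[/eqP] := h x.
by have [-> ->] := h x; rewrite eqxx.
Qed.

Lemma mate_neq m x : mating m -> m x != x.
Proof.
move=> /matingP/(_ x)[_]; apply: contraTneq => ->.
by rewrite gamma_adj_irr.
Qed.

Lemma dimer_of_block m B x : mating m -> B \in dimer_of m -> x \in B -> B = [set x; m x].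
Proof.
move=> /matingP mm /imsetP[y _ ->]; rewrite !inE => /orP[/eqP->//|/eqP->].
by have [-> _] := mm y; rewrite setUC.
Qed.

Lemma dimer_of_mem m x : [set x; m x] \in dimer_of m.
Proof. by apply/imsetP; exists x. Qed.

Lemma is_dimer_of m : mating m -> is_dimer (dimer_of m).
Proof.
move=> mm; apply/andP; split.
  apply/forall_inP => B /imsetP[x _ ->]; apply/existsP; exists x.
  apply/existsP; exists (m x); rewrite eqxx andbT.
  by have [] := matingP _ mm x.
apply/forallP => x; rewrite (_ : [set B in _ | _] = [set [set x; m x]]) ?cards1 //.
apply/setP => B; rewrite !inE; apply/andP/eqP => [[]|->].
  exact: dimer_of_block.
by rewrite dimer_of_mem !inE eqxx.
Qed.

Lemma dimer_of_inj m m' : mating m -> mating m' -> dimer_of m = dimer_of m' -> m = m'.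
Proof.
move=> mm mm' E; apply/ffunP => x.
have := dimer_of_mem m x; rewrite E => /(dimer_of_block mm') /(_ (set21 _ _)) B.
have : m x \in [set x; m' x] by rewrite -B set22.
by rewrite !inE (negPf (mate_neq _ mm)) /= => /eqP.
Qed.

Lemma dimer_ofP M : is_dimer M -> exists2 m, mating m & M = dimer_of m.
Proof.
case/andP => /forall_inP adjM /forallP covM.
have blk x : exists y, [/\ [set x; y] \in M, gamma_adj (val x) (val y) &
    forall B, B \in M -> x \in B -> B = [set x; y]].
  have /cards1P[B0 B0E] := covM x.
  have : B0 \in [set B in M | x \in B] by rewrite B0E set11.
  rewrite inE => /andP[B0M xB0].
  have uB B : B \in M -> x \in B -> B = B0.
    by move=> BM xB; apply/set1P; rewrite -B0E inE BM.
  have /existsP[a /existsP[b /andP[ab /eqP B0ab]]] := adjM _ B0M.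
  move: xB0; rewrite B0ab !inE => /orP[]/eqP xE.
    by exists b; rewrite {1 2 4}xE -B0ab; split.
  by exists a; rewrite {1 2 4}xE setUC -B0ab gamma_adj_sym; split.
have [mf Hm] := fin_all_exists blk.
pose m := [ffun x => mf x].
have mm : mating m.
  apply/matingP => x; rewrite !ffunE; have [xM xa xB] := Hm x; split=> //.
  have [yM ya yB] := Hm (mf x); have := yB _ xM (set22 _ _) => E.
  have : mf (mf x) \in [set x; mf x] by rewrite E set22.
  rewrite !inE => /orP[/eqP//|/eqP h]; move: ya; rewrite h gamma_adj_irr //.
exists m => //; apply/setP => B; apply/idP/imsetP => [BM|[x _ ->]].
  have /existsP[a /existsP[b /andP[ab /eqP B0ab]]] := adjM _ BM.
  have aB : a \in B by rewrite B0ab set21.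
  by exists a => //; have [_ _ /(_ _ BM aB)] := Hm a; rewrite ffunE.
by rewrite ffunE; have [] := Hm x.
Qed.

Definition mates m p q := [exists x : T, (val x == p) && (val (m x) == q)].

Lemma has_edge_mates m p q : mating m -> p != q -> has_edge (dimer_of m) p q = mates m p q.
Proof.
move=> mm pq; apply/exists_inP/existsP.
  case=> B BM /andP[/exists_inP[x xB /eqP xp] /exists_inP[y yB /eqP yq]].
  exists x; rewrite xp eqxx /=; move: yB; rewrite (dimer_of_block mm BM xB) !inE.
  case/orP => /eqP yx; last by rewrite -yx yq.
  by move: pq; rewrite -xp -yq yx eqxx.
case=> x /andP[xp xq]; exists [set x; m x]; first exact: dimer_of_mem.
apply/andP; split; apply/exists_inP; first by exists x; rewrite ?set21.
by exists (m x); rewrite ?set22.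
Qed.

Lemma n_dimersE : n_dimers V = #|[set m | mating m]|.
Proof.
rewrite /n_dimers (_ : [set M | _] = dimer_of @: [set m | mating m]).
  by rewrite card_in_imset // => m m'; rewrite !inE; exact: dimer_of_inj.
apply/setP => M; rewrite inE; apply/idP/imsetP => [/dimer_ofP[m mm ->]|[m]].
  by exists m; rewrite ?inE.
by rewrite inE => mm ->; exact: is_dimer_of.
Qed.

Lemma n_dimers_withE p q : p != q ->
  n_dimers_with V p q = #|[set m | mating m && mates m p q]|.
Proof.
move=> pq; rewrite /n_dimers_with (_ : [set M | _] = dimer_of @: [set m | mating m && mates m p q]).
  by rewrite card_in_imset // => m m'; rewrite !inE => /andP[? _] /andP[? _]; exact: dimer_of_inj.
apply/setP => M; rewrite inE; apply/andP/imsetP => [[/dimer_ofP[m mm ->]]|[m]].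
  by rewrite has_edge_mates // => mpq; exists m; rewrite ?inE ?mm.
by rewrite inE => /andP[mm mpq] ->; rewrite is_dimer_of // has_edge_mates.
Qed.

Lemma card_vtx (P : pred pt) : #|[set x : T | P (val x)]| = size [seq p <- undup V | P p].
Proof.
rewrite cardE -(size_map val); apply: perm_size; apply: uniq_perm.
- by rewrite map_inj_uniq ?enum_uniq //; exact: val_inj.
- by rewrite filter_uniq ?undup_uniq.
move=> p; rewrite mem_filter mem_undup; apply/mapP/andP => [[x]|[Pp pV]].
  by rewrite mem_enum inE => Px ->; rewrite Px; split=> //; exact: valP.
by exists (SeqSub pV); rewrite ?mem_enum ?inE.
Qed.

End Mates.

(** An injection given only as a relation; [agree] is used in this way in both directions between
    matings and permutations. *)
Lemma card_le_rel (T1 T2 : finType) (A : {set T1}) (B : {set T2}) (R : T1 -> T2 -> Prop) :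
  (forall x, x \in A -> exists2 y, y \in B & R x y) ->
  (forall x x' y, x \in A -> x' \in A -> R x y -> R x' y -> x = x') -> (#|A| <= #|B|)%N.
Proof.
move=> tot inj.
have /fin_all_exists[f Hf] (x : T1) : exists y : option T2,
   x \in A -> exists2 y', y = Some y' & y' \in B /\ R x y'.
  have [xA|] := boolP (x \in A); last by exists None.
  by have [y yB Ry] := tot x xA; exists (Some y) => _; exists y.
rewrite -(card_imset B Some_inj) -(card_in_imset (f := f) (D := A)).
  apply/subset_leq_card/subsetP => _ /imsetP[x xA ->].
  by have [y -> [yB _]] := Hf x xA; exact: imset_f.
move=> x x' xA x'A; have [y -> [_ Ry]] := Hf x xA; have [y' -> [_ Ry']] := Hf x' x'A.
by move=> [yy]; apply: (inj x x' y); rewrite // yy.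
Qed.

(** * Coverings counted by their impurity *)

Section Counting.
Variables (F : seq pt) (fs : pt).
Hypotheses (uF : uniq F) (F1 : all inW1 F) (scF : sc_face_union F).
Hypotheses (fs1 : inW1 fs) (fsF : fs \notin F).
Hypothesis cfs : connected_in lam_adj (fun c => c \in fs :: F).
Local Notation V := (VG F fs).
Local Notation T := (vtx V).
Local Notation G := (fs :: F).
Local Notation E := (edges F).

Let uG : uniq G. Proof. by rewrite /= fsF. Qed.

Lemma G_W1 v : v \in G -> inW1 v.
Proof. by rewrite inE => /orP[/eqP->//|/(allP F1)]. Qed.

Lemma VG_vtx (x : T) : val x \in V. Proof. exact: valP. Qed.

Lemma white_cases p : p \in V -> ~~ black p -> (p \in VH F) || (p \in G).
Proof.
rewrite mem_VG => /or3P[->//|->|/(Mids_black F1)->//]; by rewrite orbT.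
Qed.

(** The Euler formula for [F], with [fs] contributing one further white vertex. *)
Lemma size_whites : (size (undup (VH F)) + size G)%N = (size E).+2.
Proof.
have [x xV] : exists x, x \in VH F.
  have [f fF] : exists f, f \in F.
    by case: scF; case: (F) => // a s _ _ _; exists a; rewrite inE eqxx.
  exists (f.1 + 1, f.2 + 1); apply/flatten_mapP; exists f => //.
  by rewrite inE /shift eqxx.
have skF : skel_conn F by case: scF => _ /(sc_skel F1).
have exF : exact_faces F by case: scF => _ _ /(sc_exact F1).
by rewrite /= addnS (euler uF F1 xV erefl skF exF).
Qed.

Lemma card_black : #|[set x : T | black (val x)]| = size E.
Proof.
rewrite card_vtx; apply: perm_size; apply: uniq_perm.
- by rewrite filter_uniq ?undup_uniq.
- exact: undup_uniq.
move=> p; rewrite mem_filter (mem_undup V) (mem_undup (Mids F)).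
have [bp|/negPf bp] := boolP (black p); first by rewrite (VG_black F1 fs1 bp).
by apply/esym/negP => /(Mids_black F1); rewrite bp.
Qed.

Lemma card_white : #|[set x : T | ~~ black (val x)]| = (size E).+2.
Proof.
rewrite (card_vtx V (fun p => ~~ black p)) -size_whites -size_cat; apply: perm_size; apply: uniq_perm.
- by rewrite filter_uniq ?undup_uniq.
- rewrite cat_uniq undup_uniq uG andbT; apply/hasPn => f /G_W1 f1.
  by rewrite mem_undup; apply/negP => /(VH_W0 F1)/W01/(_ f1).
move=> p; rewrite mem_filter (mem_undup V) mem_cat (mem_undup (VH F)); apply/andP/idP => [[bp pV]|].
  exact: white_cases.
case/orP => [pV|pG]; rewrite mem_VG ?pV ?pG ?orbT; split=> //.
  exact/W0_white/(VH_W0 F1).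
exact/W1_white/G_W1.
Qed.

(** Partners of black vertices are white, which leaves exactly two white vertices; these must be
    matched to each other. *)
Lemma free_pair (m : {ffun T -> T}) : mating m -> exists x0,
  [/\ ~~ black (val x0), ~~ black (val (m x0)) &
    forall x, ~~ black (val x) -> ~~ black (val (m x)) -> x = x0 \/ x = m x0].
Proof.
move=> mm; have mP := matingP _ mm.
have minj : injective m by apply: (can_inj (g := m)) => x; have [] := mP x.
pose B := [set x : T | black (val x)]; pose W := [set x : T | ~~ black (val x)].
have mBW : m @: B \subset W.
  apply/subsetP => y /imsetP[b]; rewrite !inE => bb ->; have [_] := mP b.
  by apply: gamma_adj_black.
pose L := W :\: (m @: B).
have cL : #|L| = 2.
  by rewrite cardsD (setIidPr mBW) card_imset // card_white card_black subSn // subSnn.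
have inL x : (x \in L) = ~~ black (val x) && ~~ black (val (m x)).
  rewrite !inE andbC; case: (boolP (black (val x))) => //= wx; congr (~~ _).
  apply/imsetP/idP => [[b]|bmx]; first by rewrite inE => bb ->; have [->] := mP b.
  by exists (m x); rewrite ?inE //; have [->] := mP x.
have /card_gt0P[x0 x0L] : (0 < #|L|)%N by rewrite cL.
have := x0L; rewrite inL => /andP[w0 w1].
have mx0L : m x0 \in L by rewrite inL w1; have [->] := mP x0.
have LE : [set x0; m x0] = L.
  apply/eqP; rewrite eqEcard cL cards2 eq_sym (mate_neq x0 mm) andbT.
  by apply/subsetP => y; rewrite in_set2 => /orP[]/eqP->.
exists x0; split=> // x wx wmx; have : x \in L by rewrite inL wx.
by rewrite -LE in_set2 => /orP[]/eqP->; [left|right].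
Qed.

Lemma impurity (m : {ffun T -> T}) : mating m -> exists v0 w0,
  [/\ v0 \in G, w0 \in corners v0, w0 \in VH F &
    forall v w, v \in G -> w \in VH F -> mates m v w = (v == v0) && (w == w0)].
Proof.
move=> mm; have mP := matingP _ mm; have [x0 [w0 w1 L]] := free_pair mm.
(* A diagonal edge joins [W0] to [W1]; exchanging its ends makes [x0] the one in [W1]. *)
wlog x0G : x0 w0 w1 L / val x0 \in G.
  move=> H; have [xG|xG] := boolP (val x0 \in G); first exact: (H x0).
  have xV : val x0 \in VH F.
    by have := white_cases (VG_vtx x0) w0; rewrite (negPf xG) orbF.
  apply: (H (m x0)) => //.
  - by have [->] := mP x0.
  - by have [-> _] := mP x0 => x wx wmx; have [] := L x wx wmx; [right|left].
  have [_] := mP x0; rewrite gamma_adj_white // => /corners_W0.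
  rewrite (VH_W0 F1 xV) => /esym w11.
  by rewrite -VG_W1 ?VG_vtx.
have x01 := G_W1 x0G.
have cx : val (m x0) \in corners (val x0) by have [_] := mP x0; rewrite gamma_adj_white.
have wV : val (m x0) \in VH F.
  have := corners_W1 cx; rewrite x01 => /esym m0.
  by rewrite -(VG_W0 F1 fs1 m0) VG_vtx.
exists (val x0), (val (m x0)); split=> // v w vG wV'.
apply/existsP/andP => [[x /andP[/eqP xv /eqP xw]]|[/eqP-> /eqP->]]; last first.
  by exists x0; rewrite !eqxx.
have xx0 : x = x0.
  have [||//|xm] := L x; first by rewrite xv W1_white // G_W1.
    by rewrite xw W0_white // (VH_W0 F1).
  by case: (W01 (VH_W0 F1 wV)); rewrite -xm xv G_W1.
by rewrite -xv -xw xx0 !eqxx.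
Qed.

(** Double counting: for each mating exactly one pair [(v, w)] contributes, by [impurity]. *)
Lemma n_dimers_sum : n_dimers V =
  (\sum_(v <- G) \sum_(w <- corners v | w \in VH F) n_dimers_with V v w)%N.
Proof.
have vw_neq v w : v \in G -> w \in VH F -> v != w.
  by move=> /G_W1 v1 /(VH_W0 F1) w0; apply: contraTneq v1 => ->; apply/negP/W01.
transitivity (\sum_(v <- G) \sum_(w <- corners v | w \in VH F)
    \sum_(m : {ffun T -> T} | mating m) (mates m v w : nat))%N; last first.
  rewrite big_seq [RHS]big_seq; apply: eq_bigr => v vG; apply: eq_bigr => w wV.
  rewrite n_dimers_withE ?vw_neq // -sum1dep_card big_mkcondr /=.
  by apply: eq_bigr => m _; case: mates.
rewrite n_dimersE -sum1dep_card.
under [RHS]eq_bigr do rewrite exchange_big /=.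
rewrite exchange_big /=; apply: eq_bigr => m mm.
have [v0 [w0 [v0G w0c w0V H]]] := impurity mm.
rewrite (bigD1_seq v0) //= big_mkcond (bigD1_seq w0 w0c (uniq_corners v0)) /=.
rewrite w0V H // !eqxx big1 => [|w /negPf ww0]; last by case: ifP => // wV; rewrite H // ww0 andbF.
rewrite big_seq_cond big1 // => v /andP[vG /negPf vv0].
by rewrite big1 // => w wV; rewrite H // vv0.
Qed.

Section FixedImpurity.
Variables v w : pt.
Hypotheses (vF : v \in G) (wV : w \in VH F) (vw : w \in corners v).
Local Notation N := (size (prim_rows F w) + size F)%N.
Local Notation R := (rows F fs v w).

Let w0 : inW0 w. Proof. exact: VH_W0 wV. Qed.
Let v1 : inW1 v. Proof. exact: G_W1. Qed.
Let wv : (w == v) = false.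
Proof. by apply/eqP => E; case: (W01 w0); rewrite E. Qed.

Let sE : size E = N. Proof. exact: size_edges. Qed.
Let sR : size R = N. Proof. exact: size_rows. Qed.
Let uR : uniq R. Proof. exact: uniq_rows. Qed.

Lemma row_white a : a \in R -> [/\ a != v, a != w, ~~ black a & a \in V].
Proof.
rewrite (mem_rows w fsF vF) mem_VG => /orP[/andP[aV aw]|/andP[aG av]].
  have a0 := VH_W0 F1 aV; rewrite aV aw W0_white //; split=> //.
  by apply: contraTneq a0 => ->; apply/negP => /W01/(_ v1).
have a1 := G_W1 aG; rewrite aG av W1_white ?orbT //; split=> //.
by apply: contraTneq a1 => ->; apply/negP/(W01 w0).
Qed.

Lemma edge_black e : e \in E -> black e /\ e \in V.
Proof.
by rewrite mem_undup mem_VG => eM; rewrite (Mids_black F1 eM) eM !orbT.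
Qed.

Lemma VG_case p : p \in V -> [\/ p = v, p = w, exists i : 'I_N, p = fc R i |
  exists j : 'I_N, p = fc E j].
Proof.
have rowi a : a \in R -> exists i : 'I_N, a = fc R i.
  move=> ar; have la : (index a R < N)%N by rewrite -sR index_mem.
  by exists (Ordinal la); rewrite /= fc_index.
have edgei a : a \in E -> exists i : 'I_N, a = fc E i.
  move=> ar; have la : (index a E < N)%N by rewrite -sE index_mem.
  by exists (Ordinal la); rewrite /= fc_index.
move=> pV; have [->|pv] := eqVneq p v; first by constructor 1.
have [->|pw] := eqVneq p w; first by constructor 2.
move: pV; rewrite mem_VG orbA => /orP[pW|pM].
  by constructor 3; apply: rowi; rewrite (mem_rows w fsF vF) pv pw !andbT.
by constructor 4; apply: edgei; rewrite mem_undup.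
Qed.

Let rowP (i : 'I_N) : fc R i \in R. Proof. by rewrite /fc mem_nth // sR. Qed.
Let edgeP (i : 'I_N) : fc E i \in E. Proof. by rewrite /fc mem_nth // sE. Qed.

Let row_inj (i j : 'I_N) : fc R i = fc R j -> i = j.
Proof. by move/eqP; rewrite /fc nth_uniq ?sR // => /eqP/val_inj. Qed.
Let edge_inj (i j : 'I_N) : fc E i = fc E j -> i = j.
Proof. by move/eqP; rewrite /fc nth_uniq ?sE ?undup_uniq // => /eqP/val_inj. Qed.

Let Kast_adj (i j : 'I_N) : (Kast F fs v w i j != 0) = gamma_adj (fc R i) (fc E j).
Proof.
rewrite mxE intz; have [be _] := edge_black (edgeP j).
have := rowP i; rewrite (mem_rows w fsF vF) => /orP[/andP[/(VH_W0 F1) a0 _]|/andP[/G_W1 a1 _]].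
  by rewrite gamma_adj_W0_black.
by rewrite gamma_adj_W1_black.
Qed.

Let agree (m : {ffun T -> T}) (s : 'S_N) := forall (i : 'I_N) (x : T),
  val x = fc R i -> val (m x) = fc E (s i).

Let vtx_of p : p \in V -> exists x : T, val x = p.
Proof. by move=> pV; exists (SeqSub pV). Qed.

Let rowV i : exists x : T, val x = fc R (i : 'I_N).
Proof. by apply: vtx_of; have [] := row_white (rowP i). Qed.

Let perm_of_mating (m : {ffun T -> T}) : mating m -> mates m v w ->
  exists2 s : 'S_N, valid_perm (Kast F fs v w) s & agree m s.
Proof.
move=> mm /existsP[xv /andP[/eqP xvv /eqP xvw]]; have mP := matingP _ mm.
have [x0 [_ _ L]] := free_pair mm.
have partner (i : 'I_N) : exists j : 'I_N, forall x : T, val x = fc R i -> val (m x) = fc E j.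
  have [x xi] := rowV i; have [rv rw rb _] := row_white (rowP i).
  have same y : val y = fc R i -> y = x by rewrite -xi => /val_inj.
  (* A row matched to a white point would belong to the free pair, which consists of [v] and [w]. *)
  have bmx : black (val (m x)).
    apply: contraT => wmx.
    have wx : ~~ black (val x) by rewrite xi.
    have wxv : ~~ black (val xv) by rewrite xvv W1_white.
    have wmxv : ~~ black (val (m xv)) by rewrite xvw W0_white.
    have m2 : m (m x0) = x0 by have [] := mP x0.
    have [] := L _ wx wmx; have [] := L _ wxv wmxv => hxv hx.
    - by move: rv; rewrite -xi -xvv hx hxv eqxx.
    - by move: rw; rewrite -xi -xvw hx hxv m2 eqxx.
    - by move: rw; rewrite -xi -xvw hx hxv eqxx.
    - by move: rv; rewrite -xi -xvv hx hxv eqxx.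
  have := VG_vtx (m x); case/VG_case => [h|h|[j h]|[j h]].
  - by move: bmx; rewrite h (negPf (W1_white v1)).
  - by move: bmx; rewrite h (negPf (W0_white w0)).
  - by move: bmx; rewrite h; have [_ _ /negPf->] := row_white (rowP j).
  by exists j => y /same->.
have [sf Hs] := fin_all_exists partner.
have sf_inj : injective sf.
  move=> i j ij; have [x xi] := rowV i; have [y yj] := rowV j.
  have : val (m x) = val (m y) by rewrite (Hs _ _ xi) (Hs _ _ yj) ij.
  move/val_inj/(congr1 m); have [-> _] := mP x; have [-> _] := mP y => xy.
  by apply: row_inj; rewrite -xi -yj xy.
exists (perm sf_inj) => [|i x xi]; last by rewrite permE (Hs _ _ xi).
apply/forallP => i; rewrite Kast_adj permE; have [x xi] := rowV i.
by rewrite -xi -(Hs _ _ xi); have [] := mP x.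
Qed.

Let mating_of_perm (s : 'S_N) : valid_perm (Kast F fs v w) s ->
  exists2 m : {ffun T -> T}, mating m && mates m v w & agree m s.
Proof.
move=> /forallP vs.
have [r1 r1E] := lift_fun (0, 0) (fun i : 'I_N => fc E (s i)) uR sR.
have [r2 r2E] := lift_fun (0, 0) (fun j : 'I_N => fc R ((s^-1)%g j)) (undup_uniq _ : uniq E) sE.
pose mu p := if p == v then w else if p == w then v else if p \in R then r1 p else r2 p.
have muv : mu v = w by rewrite /mu eqxx.
have muw : mu w = v by rewrite /mu wv eqxx.
have muR (i : 'I_N) : mu (fc R i) = fc E (s i).
  by have [/negPf rv /negPf rw _ _] := row_white (rowP i); rewrite /mu rv rw rowP r1E.
have muE (j : 'I_N) : mu (fc E j) = fc R ((s^-1)%g j).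
  have [be _] := edge_black (edgeP j); rewrite /mu.
  have -> : (fc E j == v) = false by apply/eqP => h; move: be; rewrite h (negPf (W1_white v1)).
  have -> : (fc E j == w) = false by apply/eqP => h; move: be; rewrite h (negPf (W0_white w0)).
  have -> : (fc E j \in R) = false.
    by apply/negP => /row_white[_ _]; rewrite be.
  by rewrite r2E.
have wVG : w \in V by rewrite mem_VG wV.
have vVG : v \in V by rewrite mem_VG vF orbT.
have avw : gamma_adj v w by rewrite gamma_adj_white ?(W1_white v1) ?(W0_white w0).
have muP p : p \in V -> [/\ mu p \in V, mu (mu p) = p & gamma_adj p (mu p)].
  case/VG_case => [->|->|[i ->]|[j ->]].
  - by rewrite muv muw.
  - by rewrite muw muv gamma_adj_sym.
  - rewrite muR muE permK -Kast_adj; split=> //.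
    by have [] := edge_black (edgeP (s i)).
  rewrite muE muR permKV gamma_adj_sym; split=> //.
    by have [] := row_white (rowP ((s^-1)%g j)).
  by have := vs ((s^-1)%g j); rewrite Kast_adj permKV.
(* The default value [x] is never taken, because [mu] preserves [V]. *)
pose m : {ffun T -> T} := [ffun x => insubd x (mu (val x))].
have mE x : val (m x) = mu (val x).
  by rewrite ffunE insubdK //; have [] := muP _ (VG_vtx x).
exists m; last by move=> i x xi; rewrite mE xi muR.
apply/andP; split.
  apply/matingP => x; have [_ mm am] := muP _ (VG_vtx x).
  by split; [apply: val_inj; rewrite !mE | rewrite mE].
have [x xv] := vtx_of vVG; apply/existsP; exists x.
by rewrite mE xv muv !eqxx.
Qed.

Lemma card_impurity : n_dimers_with V v w = #|[set s | valid_perm (Kast F fs v w) s]|.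
Proof.
rewrite n_dimers_withE ?[v == w]eq_sym ?wv //; apply/eqP; rewrite eqn_leq; apply/andP; split.
  apply: (@card_le_rel _ _ _ _ agree) => [m|m m' s].
    rewrite inE => /andP[mm mvw]; have [s vs ms] := perm_of_mating mm mvw.
    by exists s; rewrite ?inE.
  rewrite !inE => /andP[mm /existsP[x /andP[/eqP xv /eqP xw]]].
  move=> /andP[mm' /existsP[x' /andP[/eqP xv' /eqP xw']]] ms ms'.
  have mP := matingP _ mm; have mP' := matingP _ mm'.
  have xx' : x = x' by apply: val_inj; rewrite xv.
  apply/ffunP => y; apply: val_inj.
  have := VG_vtx y; case/VG_case => [h|h|[i h]|[j h]].
  - have -> : y = x by apply: val_inj; rewrite xv.
    by rewrite xw xx' xw'.
  - have yx : y = m x by apply: val_inj; rewrite xw.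
    have yx' : y = m' x' by apply: val_inj; rewrite xw'.
    by rewrite {1}yx yx'; have [-> _] := mP x; have [-> _] := mP' x'; rewrite xx'.
  - by rewrite (ms _ _ h) (ms' _ _ h).
  have [z zi] := rowV ((s^-1)%g j).
  have yz : y = m z by apply: val_inj; rewrite (ms _ _ zi) permKV.
  have yz' : y = m' z by apply: val_inj; rewrite (ms' _ _ zi) permKV.
  by rewrite {1}yz yz'; have [-> _] := mP z; have [-> _] := mP' z.
apply: (@card_le_rel _ _ _ _ (fun s m => agree m s)) => [s|s s' m].
  rewrite inE => vs; have [m mm ms] := mating_of_perm vs.
  by exists m; rewrite ?inE.
move=> _ _ ms ms'; apply/permP => i; have [x xi] := rowV i.
by apply: edge_inj; rewrite -(ms _ _ xi) (ms' _ _ xi).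
Qed.

Lemma n_dimers_with_det :
  (n_dimers_with V v w)%:R = `|\det (Amx F)| * pval F fs v :> rat.
Proof. by rewrite card_impurity card_valid_Kast. Qed.

End FixedImpurity.

Hypothesis nG : connected_in gamma_adj (fun v => v \notin VG F fs).

Lemma pval_fc (i : 'I_(size F)) : pval F fs (fc F i) = pvec F fs i 0.
Proof.
rewrite /pval; case: eqP => [fi|_]; first by move: fsF; rewrite -fi fc_mem.
case: pickP => [j /eqP ij|/(_ i)]; last by rewrite eqxx.
by congr (pvec F fs _ _); apply/eqP; rewrite -(fc_inj _ _ uF) ij.
Qed.

Lemma sum_pval : \sum_(v <- F) pval F fs v = \sum_(i < size F) pvec F fs i 0.
Proof. by rewrite -sum_fc; apply: eq_bigr => i _; rewrite pval_fc. Qed.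

(** Each face of [F] has all four corners in [H], while [fs] has [dstar F fs + 1] of them and
    potential one. *)
Lemma n_dimers_det : (n_dimers V)%:R =
  `|\det (Amx F)| * (4 * \sum_(i < size F) pvec F fs i 0 + (dstar F fs)%:R + 1) :> rat.
Proof.
have inner v : v \in G -> (\sum_(w <- corners v | w \in VH F) n_dimers_with V v w)%:R =
    (count (fun w => w \in VH F) (corners v))%:R * (`|\det (Amx F)| * pval F fs v) :> rat.
  move=> vG; rewrite natr_sum -sum1_count natr_sum mulr_suml big_seq_cond [RHS]big_seq_cond.
  apply: eq_bigr => w /andP[wv wV].
  by rewrite n_dimers_with_det // mul1r.
rewrite n_dimers_sum natr_sum big_seq.
rewrite (eq_bigr _ inner) -big_seq big_cons corners_count //.
rewrite {1}/pval eqxx mulr1 big_seq.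
under eq_bigr => f fF.
  have -> : count (fun w => w \in VH F) (corners f) = 4.
    apply/eqP; rewrite -[4]/(size (corners f)) -all_count; apply/allP => x xc.
    by apply/flatten_mapP; exists f.
  over.
rewrite -big_seq -!mulr_sumr sum_pval -natr1; ring.
Qed.

End Counting.

Theorem mainTheorem9 (F : seq pt) (fs vs : pt) :
  uniq F -> all inW1 F -> sc_face_union F ->
  inW1 fs -> fs \notin F -> sc_lattice_subgraph (fs :: F) ->
  vs \in VH F -> outer_boundary F vs -> dvec vs fs \in diag_steps ->
  normal_graph (VG F fs) ->
  (forall v w : pt, v \in fs :: F -> w \in VG F fs ->
      gamma_adj v w -> dvec v w \in diag_steps ->
      (n_dimers_with (VG F fs) v w)%:R = `|\det (Amx F)| * pval F fs v)
  /\ (n_dimers (VG F fs))%:R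
       = `|\det (Amx F)| * (4 * \sum_(v <- fs :: F) pval F fs v + (dstar F fs)%:R - 3)
  /\ (n_dimers (VG F fs))%:R
       = `|\det (Amx F)| * (4 * \sum_(i < size F) pvec F fs i ord0 + (dstar F fs)%:R + 1).
Proof.
move=> uF F1 scF fs1 fsF [cfs _] _ _ _ [_ nG].
have total := n_dimers_det uF F1 scF fs1 fsF cfs nG.
split; last split => //.
  move=> v w vG wV _; rewrite mem_diag_steps => wc; apply: n_dimers_with_det => //.
  have v1 : inW1 v by apply: G_W1 vG.
  by rewrite -(VG_W0 F1 fs1) // -(corners_W1 wc).
(* The term of [fs] in the sum contributes [4], which accounts for [-3] in place of [+1]. *)
rewrite total big_cons sum_pval // {1}/pval eqxx; ring.
Qed.
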